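(* Let the density-greedy algorithm for general graphs be as defined in the context. Then (i) for every instance, the output $\pi$ of the algorithm satisfies $2\,p(\textsc{Alg}(B+\gamma))\ge p(\textsc{Opt}(B))$ for all $B\in\mathbb{R}_{\ge0}$, where $\gamma$ is the maximum cost of a simple path in $G$ starting at $r$; i.e., the algorithm is $(\gamma,2)$-competitive. (ii) The algorithm is not $(\chi,\mu)$-competitive for any $\mu\ge1$: there exists an instance, with root eccentricity $\chi$, on which for every $\mu\ge1$ the output satisfies $\mu\,p(\textsc{Alg}(B+\chi))<p(\textsc{Opt}(B))$ for some $B\ge 0$.
   Context: An instance consists of a finite undirected graph $G=(V,E)$, edge costs $c(e)>0$, vertex prizes $p(v)\ge 0$, and a root $r\in V$. For a subgraph $G'=(V',E')$ write $p(G')=\sum_{v\in V'}p(v)$, $c(G')=\sum_{e\in E'}c(e)$. A rooted subtree is a subtree containing $r$. For $B\ge0$, $\textsc{Opt}(B)$ is a rooted subtree maximizing $p(T)$ subject to $c(T)\le B$. Let $V^*=\{v:p(v)>0\}$. An incremental solution is a sequence $\pi=(e_1,\dots,e_l)$ of distinct edges such that every prefix, together with $r$, forms a rooted subtree and the whole sequence spans $V^*$. For $B\ge0$, $\textsc{Alg}(B)$ is the rooted subtree formed by $r$ and the edges $e_i$ of the output $\pi$ with $\sum_{j\le i}c(e_j)\le B$. An algorithm is $(\alpha,\mu)$-competitive if for every instance its output satisfies $\mu\,p(\textsc{Alg}(B+\alpha))\ge p(\textsc{Opt}(B))$ for all $B\ge0$. Root eccentricity: $\chi=\max_v\ell(v)$,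 $\ell(v)$ the minimum cost of an $r$-$v$ path. Density: for a rooted subtree $T$ (of a multigraph with root $r$) with at least one edge, $d(T)=p(T)/c(T)$; the trivial tree has density $0$. A min-max subtree is an inclusion-wise minimal rooted subtree among those of maximum density. Contraction: for a rooted subtree $\overline{T}$ of $G$, $G/\overline{T}$ is obtained by identifying all vertices of $\overline T$ with $r$ and deleting the edges of $\overline T$, keeping all other edges (possibly as parallel edges or loops) with their costs; each edge of $G/\overline T$ corresponds to a unique edge of $G$ not in $\overline T$; prizes are unchanged except the root gets prize $0$. For a subgraph $C$ of $G/\overline T$, its extension $C^+$ is the subgraph of $G$ formed by the edges of $G$ corresponding to the edges of $C$. Density-greedy algorithm for trees (input: a tree $H$ with root $r$): $\pi=()$, $\overline T=(\{r\},\emptyset)$; while $H/\overline T$ has nonzero total prize, choose any min-max subtree $T^*$ of $H/\overline T$, append to $\pi$ the edge of $H$ corresponding to the unique edge of $T^*$ incident to $r$, and add that edge to $\overline T$; output $\pi$. Density-greedy algorithm for general graphs: $\pi=()$, $\overline T=(\{r\},\emptyset)$; while $G/\overline T$ has nonzero total prize: choose an arbitrary min-max subtree $T^*$ of $G/\overline T$, let $T^+$ be its extension in $G$, run the density-greedy algorithm for trees on the tree $T^*$ (with root $r$), append the corresponding edges of $G$ in that order to $\pi$, and add the edges of $T^+$ to $\overline T$. Output $\pi$. *)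

(* Defs.v *)
From mathcomp Require Import all_boot all_order ssralg ssrnum reals.

Set Implicit Arguments.
Unset Strict Implicit.
Unset Printing Implicit Defensive.

Import Order.TTheory GRing.Theory Num.Theory.
Local Open Scope ring_scope.

(* Rooted multigraphs inside ambient finite types V of vertex names and E of
   edge names. [ends e] is the set of endpoints of [e]: a singleton for a loop,
   a pair otherwise; parallel edges are distinct names with equal [ends].
   Since edge names are stable under contraction and under passing to a
   subgraph, the correspondence between edges of a contraction and edges of the
   original graph is the identity of E. *)
Record rooted_mgraph (R : realType) (V E : finType) := RootedMGraph {
  verts : {set V};
  edges : {set E};
  ends : E -> {set V};
  rt : V;
  cost : E -> R;
  prize : V -> R }.

Section Graphs.
Variables (R : realType) (V E : finType).
Implicit Types (G H : rooted_mgraph R V E) (s : seq (E * V)) (pi : seq E).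

(* The list [(e1, v1); (e2, v2); ...] encodes the walk x, e1, v1, e2, v2, ... *)
Fixpoint walk G (x : V) s : bool :=
  if s is (e, y) :: s' then
    [&& e \in edges G, ends G e == [set x; y] & walk G y s']
  else true.

Definition walk_end (x : V) s : V := last x (unzip2 s).

Definition simple_path G (x : V) s : bool :=
  walk G x s && uniq (x :: unzip2 s).

Definition path_cost G s : R := \sum_(a <- s) cost G a.1.

(* Loops are cycles of length 1, pairs of parallel edges cycles of length 2. *)
Definition cycle_at G (x : V) s : bool :=
  [&& s != [::], walk G x s, walk_end x s == x,
      uniq (unzip1 s) & uniq (unzip2 s)].

Definition reachable G (x y : V) : Prop :=
  exists2 s, walk G x s & walk_end x s = y.

Definition connected G : Prop :=
  forall x y, x \in verts G -> y \in verts G -> reachable G x y.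

Definition acyclic G : Prop := forall x s, ~~ cycle_at G x s.

Definition tree G : Prop := connected G /\ acyclic G.

(* A subgraph is given by its vertex set and its edge set. *)
Definition sgraph : Type := {set V} * {set E}.
Implicit Types S T C : sgraph.

Definition subgraph G S : Prop :=
  [/\ S.1 \subset verts G, S.2 \subset edges G
    & forall e, e \in S.2 -> ends G e \subset S.1].

Definition as_graph G S : rooted_mgraph R V E :=
  RootedMGraph S.1 S.2 (ends G) (rt G) (cost G) (prize G).

Definition rooted_subtree G T : Prop :=
  [/\ subgraph G T, rt G \in T.1 & tree (as_graph G T)].

Definition sprize G S : R := \sum_(v in S.1) prize G v.
Definition scost G S : R := \sum_(e in S.2) cost G e.

Definition root_only G : sgraph := ([set rt G], set0).

Definition sunion S T : sgraph := (S.1 :|: T.1, S.2 :|: T.2).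

(* The subgraph of G formed by the edges in F and their endpoints. *)
Definition edge_sgraph G (F : {set E}) : sgraph :=
  (\bigcup_(e in F) ends G e, F).

(* A finite simple undirected graph with positive costs and nonnegative prizes.
   The last condition is exactly what makes an incremental solution exist. *)
Definition instance G : Prop :=
  [/\ [/\ rt G \in verts G,
          forall e, e \in edges G -> ends G e \subset verts G,
          forall e, e \in edges G -> #|ends G e| = 2
        & {in edges G &, injective (ends G)}],
      forall e, e \in edges G -> 0 < cost G e,
      forall v, v \in verts G -> 0 <= prize G v
    & forall v, v \in verts G -> 0 < prize G v -> reachable G (rt G) v].

Definition optimal G (B : R) T : Prop :=
  [/\ rooted_subtree G T, scost G T <= B
    & forall T', rooted_subtree G T' -> scost G T' <= B ->
        sprize G T' <= sprize G T].

(* The subgraph formed by the root and the edges in F. *)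
Definition with_root G (F : {set E}) : sgraph :=
  sunion (root_only G) (edge_sgraph G F).

Definition incremental_solution G pi : Prop :=
  [/\ uniq pi,
      forall i, (i <= size pi)%N ->
        rooted_subtree G (with_root G [set e in take i pi])
    & forall v, v \in verts G -> 0 < prize G v ->
        v \in (with_root G [set e in pi]).1].

Definition alg G pi (B : R) : sgraph :=
  with_root G [set tnth (in_tuple pi) i | i : 'I_(size pi)
                 & \sum_(e <- take i.+1 pi) cost G e <= B].

Definition is_dist G (v : V) (d : R) : Prop :=
  (exists s, [/\ simple_path G (rt G) s, walk_end (rt G) s = v
               & path_cost G s = d]) /\
  (forall s, simple_path G (rt G) s -> walk_end (rt G) s = v ->
     d <= path_cost G s).

(* Since all distances are required to exist, G is connected. *)
Definition is_eccentricity G (chi : R) : Prop :=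
  (exists2 v, v \in verts G & is_dist G v chi) /\
  (forall v, v \in verts G -> exists2 d, is_dist G v d & d <= chi).

Definition is_max_path_cost G (gamma : R) : Prop :=
  (exists2 s, simple_path G (rt G) s & path_cost G s = gamma) /\
  (forall s, simple_path G (rt G) s -> path_cost G s <= gamma).

Definition density G T : R :=
  if T.2 == set0 then 0 else sprize G T / scost G T.

Definition max_density G T : Prop :=
  rooted_subtree G T /\
  forall T', rooted_subtree G T' -> density G T' <= density G T.

Definition min_max_subtree G T : Prop :=
  max_density G T /\
  forall T', max_density G T' -> T'.1 \subset T.1 -> T'.2 \subset T.2 -> T' = T.

Definition contract G T : rooted_mgraph R V E :=
  RootedMGraph (rt G |: (verts G :\: T.1)) (edges G :\: T.2)
    (fun e => [set (if v \in T.1 then rt G else v) | v in ends G e])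
    (rt G) (cost G) (fun v => if v == rt G then 0 else prize G v).

Definition total_prize G : R := \sum_(v in verts G) prize G v.

Definition extension G C : sgraph := edge_sgraph G C.2.

(* [tree_run H T pi]: with current subtree T, the remaining iterations of the
   loop may append the edges pi. The possible choices of min-max subtrees make
   this a relation rather than a function. *)
Inductive tree_run H : sgraph -> seq E -> Prop :=
| tree_run_stop T :
    total_prize (contract H T) = 0 -> tree_run H T [::]
| tree_run_step T Tmm e pi :
    total_prize (contract H T) != 0 ->
    min_max_subtree (contract H T) Tmm ->
    [set f in Tmm.2 | rt H \in ends (contract H T) f] = [set e] ->
    tree_run H (sunion T (edge_sgraph H [set e])) pi ->
    tree_run H T (e :: pi).

Definition tree_density_greedy H pi : Prop := tree_run H (root_only H) pi.

Inductive graph_run G : sgraph -> seq E -> Prop :=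
| graph_run_stop T :
    total_prize (contract G T) = 0 -> graph_run G T [::]
| graph_run_step T Tmm sigma pi :
    total_prize (contract G T) != 0 ->
    min_max_subtree (contract G T) Tmm ->
    tree_density_greedy (as_graph (contract G T) Tmm) sigma ->
    graph_run G (sunion T (extension G Tmm)) pi ->
    graph_run G T (sigma ++ pi).

Definition density_greedy G pi : Prop := graph_run G (root_only G) pi.

End Graphs.

(* An algorithm with arbitrary choices is the relation A between instances and
   possible outputs. As an algorithm for the incremental problem it has to
   produce an output, and every output has to be an incremental solution. The
   parameter alpha of the instance is given by its graph. *)
Definition competitive (R : realType)
    (A : forall V E : finType, rooted_mgraph R V E -> seq E -> Prop)
    (alpha : forall V E : finType, rooted_mgraph R V E -> R -> Prop) (mu : R) : Prop :=
  forall (V E : finType) (G : rooted_mgraph R V E), instance G ->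
  forall a : R, alpha V E G a ->
  (exists pi, A V E G pi) /\
  forall pi, A V E G pi ->
    incremental_solution G pi /\
    forall B : R, 0 <= B -> forall T, optimal G B T ->
      mu * sprize G (alg G pi (B + a)) >= sprize G T.

(* Main.v *)
(* For a rooted subtree T, the rooted subtrees of G/T correspond to the rooted
   subtrees of G that contain T, so densities in all contractions are compared
   within the latter. Inside a min-max subtree of density d, the tree algorithm
   completes every nested min-max subtree that it enters (and whose density is
   larger than d) before it adds anything else. Hence, when it is about to add an
   edge e, all edges added so far, including e, are paid for at rate d by the
   collected prizes, except those on the path from the root to e, which cost at
   most gamma. As the densities of the successive min-max subtrees of G do not
   increase, Alg(B + gamma) is worth at least d B, and Opt(B) exceeds it by at
   most d B.

   For eccentricity instead of gamma, a long prize-free path can belong to the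
   densest subtree although each of its vertices has a shorter connection to the
   root: on a graph with five edges the algorithm spends more than chi + 2 before
   it reaches any prize, while a prize is available at distance 2. *)

Require Import Defs.
From mathcomp Require Import all_boot all_order ssralg ssrnum reals.
From mathcomp Require Import boolp lra.

Set Implicit Arguments.
Unset Strict Implicit.
Unset Printing Implicit Defensive.

Import Order.TTheory GRing.Theory Num.Theory.
Local Open Scope ring_scope.

(** A rooted subtree is handled as its set of edges, built by attaching leaves ([grown]), and a
    subtree of a contraction as a difference of two such sets; densities become linear inequalities
    between [pz] and [ct]. The nesting rests on modularity. Inside one tree the prize is a sum over
    edges, each charged with its farther end, so union and intersection together are worth as much
    as the two parts. A min-max subtree that crossed the border of the one being completed would
    split into an outer part of density at most d and an inner part of density at most its own d' >
    d, too little together. In the graph itself a union of two trees may contain cycles; there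
    [grown_join] serves for the comparison with the optimum. The exempt path is measured from the
    current subtree, because this form survives the recursion: the first edge of a nested subtree
    lies on the path to all its edges, so its unpaid cost moves into the exemption. A path of a
    contraction need not come from a path of G, so gamma enters only at the end, through the path in
    the tree [T :|: M] of G. *)

Lemma set_extend_ind (E : finType) (P : {set E} -> Prop) (A0 A : {set E}) :
  P A0 -> A0 \subset A ->
  (forall Z : {set E}, A0 \subset Z -> Z \proper A -> P Z ->
     exists2 e, e \in A :\: Z & P (e |: Z)) ->
  P A.
Proof.
move=> P0 sA0A Pstep.
have [n] := ubnP #|A :\: A0|; elim: n => // n IHn in A0 P0 sA0A Pstep *.
rewrite ltnS => leAn.
have [/eqP <- //|neA] := boolP (A0 == A).
have pA : A0 \proper A by rewrite properEneq neA.
have [e eA Pe] := Pstep _ (subxx _) pA P0.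
move: (eA); rewrite inE => /andP[eA0 eA'].
apply: (IHn (e |: A0)) => //.
- by rewrite subUset sub1set eA'.
- by move=> Z /(subset_trans (subsetUr _ _)); apply: Pstep.
apply: leq_trans leAn; apply: proper_card; apply/properP; split.
  by apply: setDS; apply: subsetUr.
by exists e => //; rewrite !inE eqxx.
Qed.

(** * Walks *)

Section Walks.
Variables (R : realType) (V E : finType).
Implicit Types (G H : rooted_mgraph R V E) (s : seq (E * V)).

Lemma walk_end_cat (x : V) s1 s2 :
  walk_end x (s1 ++ s2) = walk_end (walk_end x s1) s2.
Proof. by rewrite /walk_end /unzip2 map_cat last_cat. Qed.

Lemma walk_cat G (x : V) s1 s2 :
  walk G x (s1 ++ s2) = walk G x s1 && walk G (walk_end x s1) s2.
Proof.
elim: s1 x => [|[e y] s1 IHs] x //=.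
by rewrite IHs -!andbA.
Qed.

Lemma walk_edges G x s e : walk G x s -> e \in unzip1 s -> e \in edges G.
Proof.
elim: s x => [|[f y] s IHs] x //= /and3P[fG _ ws].
by rewrite inE => /orP[/eqP-> //|]; apply: IHs ws.
Qed.

Lemma walk_rev G (x : V) s :
  walk G x s -> exists2 s', walk G (walk_end x s) s' & walk_end (walk_end x s) s' = x.
Proof.
elim: s x => [|[e y] s IHs] x /=; first by exists [::].
move=> /and3P[eG ends_e /IHs[s' ws' es']].
exists (s' ++ [:: (e, x)]); last by rewrite walk_end_cat.
by rewrite walk_cat ws' /= es' eG (eqP ends_e) setUC eqxx.
Qed.

Lemma walk_shorten G (x : V) s :
  walk G x s -> exists2 s', simple_path G x s' & walk_end x s' = walk_end x s.
Proof.
elim: s x => [|[e y] s IHs] x /=; first by exists [::].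
move=> /and3P[eG ends_e /IHs[s' /andP[ws' us'] es']].
have -> : walk_end x ((e, y) :: s) = walk_end y s by [].
rewrite -es'.
have [|xs'] := boolP (x \in y :: unzip2 s'); last first.
  by exists ((e, y) :: s') => //; rewrite /simple_path /= eG ends_e ws' xs'.
rewrite inE => /orP[/eqP->|/mapP[[f z] fzs' /= ->]].
  by exists s' => //; rewrite /simple_path ws'.
have [s1 [s2 Es']] : exists s1 s2, s' = s1 ++ (f, z) :: s2.
  by case/splitPr: fzs' => s1 s2; exists s1, s2.
exists s2; last by rewrite Es' walk_end_cat.
move: ws' us'; rewrite /simple_path Es' walk_cat /= => /and4P[_ _ _ ->].
by rewrite /unzip2 map_cat cat_uniq /= => /and5P[_ _ _ -> ->].
Qed.

Lemma simple_path_uniq_edges G (x : V) s : simple_path G x s -> uniq (unzip1 s).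
Proof.
elim: s x => [|[e y] s IHs] x //=.
rewrite /simple_path /= => /and3P[/and3P[eG /eqP ends_e ws] xs us].
rewrite (IHs y) ?/simple_path ?ws // andbT.
apply/negP => es.
have : x \in y :: unzip2 s.
  have /subsetP sub : ends G e \subset y :: unzip2 s; last first.
    by apply: sub; rewrite ends_e !inE eqxx.
  elim: s y ws es {IHs us xs ends_e} => [|[f z] s IHs] y //= /and3P[fG /eqP ends_f ws].
  rewrite inE => /orP[/eqP->|es].
    by rewrite ends_f; apply/subsetP => v; rewrite !inE orbA => ->.
  apply: (subset_trans (IHs z ws es)); apply/subsetP => v vz.
  by rewrite inE vz orbT.
by rewrite (negPf xs).
Qed.

Lemma cycle_rot G (x : V) s1 s2 :
  cycle_at G x (s1 ++ s2) -> cycle_at G (walk_end x s1) (s2 ++ s1).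
Proof.
rewrite /cycle_at walk_cat walk_end_cat.
move=> /and5P[ne /andP[w1 w2] /eqP ex u1 u2].
rewrite walk_cat walk_end_cat w2 ex w1 eqxx.
rewrite /unzip1 /unzip2 !map_cat !(uniq_catC (map _ s2)) -!map_cat u1 u2 !andbT.
by move: ne; rewrite -!size_eq0 !size_cat addnC.
Qed.

(** After a rotation the cycle starts with [e]; its last edge then meets one end of [e] and its
    second edge the other. In this way an edge that ends in a leaf is seen to lie on no cycle. *)
Lemma cycle_incident G (x : V) s e (a : V) :
  cycle_at G x s -> e \in unzip1 s -> #|ends G e| = 2%N -> a \in ends G e ->
  exists2 f, f \in unzip1 s & (f != e) && (a \in ends G f).
Proof.
move=> cyc es card_e ae.
have [s1 [s2 [z Es]]] : exists s1 s2 z, s = s1 ++ (e, z) :: s2.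
  case/mapP: es => [[e' z] es /= ->].
  by case/splitPr: es => s1 s2; exists s1, s2, z.
have perm_s : unzip1 s =i unzip1 ((e, z) :: s2 ++ s1).
  by move=> f; rewrite Es -cat_cons /unzip1 !map_cat !mem_cat orbC.
suff [f fs fa] : exists2 f, f \in unzip1 ((e, z) :: s2 ++ s1) &
    (f != e) && (a \in ends G f) by exists f; rewrite // perm_s.
move: cyc; rewrite Es => /cycle_rot; rewrite cat_cons.
move: (walk_end x s1) (s2 ++ s1) => y t /and5P[_ /= /and3P[eG /eqP ends_e wt]].
move=> /eqP et /andP[et1 _] _.
have yz : y != z.
  by apply/eqP => yz; move: card_e; rewrite ends_e yz setUid cards1.
move: ae; rewrite ends_e !inE => /orP[] /eqP ->.
  case/lastP: t => [|t [f v]] in wt et et1 *.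
    by rewrite /walk_end /= in et; rewrite et eqxx in yz.
  move: wt et et1; rewrite -cats1 walk_cat /= => /and3P[_ _ /andP[/eqP ends_f _]].
  rewrite /walk_end /unzip1 /unzip2 !map_cat /= -/(unzip1 _).
  rewrite map_cat last_cat /= => vy; rewrite mem_cat negb_or !inE => /andP[_ ef].
  exists f; first by rewrite inE mem_cat !inE eqxx !orbT.
  by rewrite eq_sym ef ends_f -vy !inE eqxx orbT.
case: t => [|[f v] t] in wt et et1 *.
  by rewrite /walk_end /= in et; rewrite et eqxx in yz.
move: wt et1 => /= /and3P[_ /eqP ends_f _]; rewrite inE negb_or => /andP[ef _].
exists f; first by rewrite !inE eqxx orbT.
by rewrite eq_sym ef ends_f !inE eqxx.
Qed.

End Walks.

(** * Rooted subtrees as growing edge sets *)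

Section Growth.
Variables (R : realType) (V E : finType).
Implicit Types (G H : rooted_mgraph R V E) (F T X Y Z : {set E}).

(** The structural part of [instance] that survives contraction: loops ([x = y]) and parallel edges
    are allowed. *)
Definition wf_mgraph G : Prop :=
  [/\ rt G \in verts G, forall e, e \in edges G -> ends G e \subset verts G
    & forall e, e \in edges G -> exists x y, ends G e = [set x; y]].

(* Locked: otherwise [inE] unfolds it. *)
Definition vset G F : {set V} := locked (rt G |: \bigcup_(e in F) ends G e).

Lemma vsetE G F : vset G F = rt G |: \bigcup_(e in F) ends G e.
Proof. by rewrite /vset -lock. Qed.

(** The edge sets of rooted subtrees, by [grown_rooted_subtree] and [rooted_subtree_grown].
    Connectedness and acyclicity are traded for an induction on leaf attachments. *)
Inductive grown G : {set E} -> Prop :=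
| grown0 : grown G set0
| grownU1 F e x y : grown G F -> e \in edges G -> ends G e = [set x; y] ->
    x \in vset G F -> y \notin vset G F -> grown G (e |: F).

Lemma with_rootE G F : with_root G F = (vset G F, F).
Proof. by rewrite /with_root /sunion /= set0U vsetE. Qed.

Lemma vset0 G : vset G set0 = [set rt G].
Proof. by rewrite vsetE big_set0 setU0. Qed.

Lemma rt_vset G F : rt G \in vset G F.
Proof. by rewrite vsetE setU11. Qed.

Lemma vsetU1 G e F : vset G (e |: F) = ends G e :|: vset G F.
Proof. by rewrite !vsetE bigcup_setU big_set1 setUCA. Qed.

Lemma vsetS G F F' : F \subset F' -> vset G F \subset vset G F'.
Proof.
move=> sFF'; rewrite !vsetE; apply: setUS; apply/bigcupsP => e eF.
by apply: bigcup_sup; apply: (subsetP sFF').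
Qed.

Lemma ends_vset G F e : e \in F -> ends G e \subset vset G F.
Proof. by move=> eF; rewrite vsetE; apply: subset_trans (subsetUr _ _); apply: bigcup_sup. Qed.

Lemma vsetP G F v :
  reflect (v = rt G \/ exists2 e, e \in F & v \in ends G e) (v \in vset G F).
Proof.
rewrite vsetE in_setU1; apply: (iffP orP) => -[].
- by move/eqP; left.
- by case/bigcupP => e eF ve; right; exists e.
- by move=> ->; left.
by case=> e eF ve; right; apply/bigcupP; exists e.
Qed.

Lemma vset_leaf G F e x y : ends G e = [set x; y] -> x \in vset G F ->
  vset G (e |: F) = y |: vset G F.
Proof.
move=> ends_e xF; rewrite vsetU1 ends_e -setUA setUCA.
by congr (_ |: _); apply/setUidPr; rewrite sub1set.
Qed.

Lemma notin_leaf G F e x y : ends G e = [set x; y] -> y \notin vset G F -> e \notin F.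
Proof.
move=> ends_e; apply: contra => /(ends_vset G)/subsetP; apply.
by rewrite ends_e set22.
Qed.

Lemma grown_edges G F : grown G F -> F \subset edges G.
Proof.
elim=> [|{}F e x y _ sFG eG _ _ _]; first exact: sub0set.
by rewrite subUset sub1set eG.
Qed.

Lemma vset_verts G F : wf_mgraph G -> F \subset edges G -> vset G F \subset verts G.
Proof.
case=> rG eG _ sFG; rewrite vsetE subUset sub1set rG /=.
by apply/bigcupsP => e eF; apply: eG; apply: (subsetP sFG).
Qed.

Lemma card_vset G F : grown G F -> #|vset G F| = #|F|.+1.
Proof.
elim=> [|{}F e x y gF cF eG ends_e xF yF]; first by rewrite vset0 cards1 cards0.
rewrite (vset_leaf ends_e xF) (cardsU1 y (vset G F)) (cardsU1 e F).
by rewrite yF cF (notin_leaf ends_e yF).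
Qed.

(** The union of two trees may contain cycles. Replaying the growth of [F] on top of [T] and
    skipping each edge whose new vertex is already covered keeps the vertices and adds only edges of
    [F]. *)
Lemma grown_join G T F : grown G T -> grown G F ->
  exists Z, [/\ grown G Z, T \subset Z, Z \subset T :|: F
              & vset G Z = vset G T :|: vset G F].
Proof.
move=> gT; elim=> [|{}F e x y gF [Z [gZ sTZ sZ vZ]] eG ends_e xF yF].
  exists T; split=> //; first by rewrite setU0.
  by rewrite vset0 setUC; apply/esym/setUidPr; rewrite sub1set rt_vset.
have sZ' : Z \subset T :|: (e |: F) by rewrite setUCA (subset_trans sZ) // subsetUr.
have vE : vset G T :|: vset G (e |: F) = y |: vset G Z.
  by rewrite (vset_leaf ends_e xF) vZ setUCA.
rewrite vE; have [yZ|yZ] := boolP (y \in vset G Z).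
  by exists Z; split=> //; apply/esym/setUidPr; rewrite sub1set.
have xZ : x \in vset G Z by rewrite vZ inE xF orbT.
exists (e |: Z); split.
- exact: (grownU1 gZ eG ends_e xZ yZ).
- by rewrite (subset_trans sTZ) // subsetUr.
- by rewrite subUset sZ' andbT sub1set !inE eqxx orbT.
exact: vset_leaf ends_e xZ.
Qed.

(** A rooted subtree has one vertex more than edges, so [Y] has a vertex outside [vset G T]; along
    the growth of [Y] some edge must be the first to leave [vset G T]. *)
Lemma grown_step G T Y : grown G T -> grown G Y -> T \proper Y ->
  exists e x y, [/\ e \in Y :\: T, ends G e = [set x; y], x \in vset G T
                  & y \notin vset G T].
Proof.
move=> gT gY pTY.
have nsub : ~~ (vset G Y \subset vset G T).
  apply/negP => /subset_leq_card; rewrite !card_vset // ltnS leqNgt.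
  by rewrite proper_card.
suff [|//] : vset G Y \subset vset G T \/
    exists e x y, [/\ e \in Y :\: T, ends G e = [set x; y], x \in vset G T
                  & y \notin vset G T].
  by move=> sub; rewrite sub in nsub.
elim: gY {pTY nsub} => [|{}Y e x y gY IHY eG ends_e xY yY].
  by left; rewrite vset0 sub1set rt_vset.
case: IHY => [sYT|[f [a [b [fY]]]]]; last first.
  right; exists f, a, b; split=> //.
  by move: fY; rewrite !inE => /andP[-> ->]; rewrite orbT.
have [yT|yT] := boolP (y \in vset G T).
  by left; rewrite (vset_leaf ends_e xY) subUset sub1set yT.
right; exists e, x, y; split=> //; last exact: (subsetP sYT).
by rewrite inE (notin_leaf ends_e yT) setU11.
Qed.

Lemma grown_attach G T Y : grown G T -> grown G Y -> T \proper Y ->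
  exists2 e, e \in Y :\: T & grown G (e |: T).
Proof.
move=> gT gY pTY; have [e [x [y [eY ends_e xT yT]]]] := grown_step gT gY pTY.
exists e => //; apply: (grownU1 gT _ ends_e xT yT).
by move: eY; rewrite inE => /andP[_]; apply/subsetP/grown_edges.
Qed.

Lemma walk_grown G T x s : grown G T -> x \in vset G T -> walk G x s ->
  exists X, [/\ grown G X, T \subset X & walk_end x s \in vset G X].
Proof.
elim: s x T => [|[e y] s IHs] x T gT xT /=; first by exists T.
move=> /and3P[eG /eqP ends_e ws].
have [yT|yT] := boolP (y \in vset G T).
  by have [X [gX sX vX]] := IHs y T gT yT ws; exists X.
have gT' := grownU1 gT eG ends_e xT yT.
have [|X [gX sX vX]] := IHs y _ gT' _ ws.
  by rewrite (vset_leaf ends_e xT) setU11.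
by exists X; split=> //; apply: subset_trans sX; apply: subsetUr.
Qed.

Lemma walk_sub G (X Y : sgraph V E) x s : X.2 \subset Y.2 ->
  walk (as_graph G X) x s -> walk (as_graph G Y) x s.
Proof.
move=> sXY; elim: s x => [|[e y] s IHs] x //= /and3P[eX -> ws].
by rewrite (subsetP sXY) //= IHs.
Qed.

Lemma grown_walk G F v : grown G F -> v \in vset G F ->
  exists2 s, walk (as_graph G (with_root G F)) (rt G) s & walk_end (rt G) s = v.
Proof.
rewrite with_rootE => gF; elim: gF v => [|{}F e x y gF IHF eG ends_e xF yF] v.
  by rewrite vset0 inE => /eqP->; exists [::].
have sub : F \subset e |: F := subsetUr _ _.
rewrite (vset_leaf ends_e xF) inE => /orP[|/IHF[s ws es]]; last first.
  by exists s => //; apply: walk_sub ws.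
rewrite inE => /eqP->; have [s ws es] := IHF x xF.
exists (s ++ [:: (e, y)]); last by rewrite walk_end_cat.
rewrite walk_cat /= es setU11 ends_e eqxx !andbT.
exact: walk_sub ws.
Qed.

Lemma grown_connected G F : grown G F -> connected (as_graph G (with_root G F)).
Proof.
move=> gF x y; rewrite with_rootE /= => /(grown_walk gF)[s ws es].
move=> /(grown_walk gF)[t wt et]; rewrite with_rootE in ws wt.
have [s' ws' es'] := walk_rev ws; rewrite es in ws' es'.
exists (s' ++ t); last by rewrite walk_end_cat es'.
by rewrite walk_cat ws' es'.
Qed.

(** A cycle through the last attached edge would need a second edge at the new leaf, and there is
    none; any other cycle lies in the smaller tree. *)
Lemma grown_acyclic G F : grown G F -> acyclic (as_graph G (with_root G F)).
Proof.
elim=> [|{}F e x y gF IHF eG ends_e xF yF] z s; apply/negP.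
  case: s => [|[e y] s] //.
  by rewrite /cycle_at /= !inE.
rewrite with_rootE => cyc.
have xy : x != y by apply: contraNneq yF => <-.
have [es|es] := boolP (e \in unzip1 s).
  have := cycle_incident cyc es; rewrite /= ends_e cards2 xy => /(_ y erefl).
  rewrite set22 => /(_ isT) [f fs /andP[fe yf]].
  case/and5P: cyc => _ /walk_edges/(_ fs) /=; rewrite !inE (negPf fe) /=.
  by move=> /(ends_vset G)/subsetP/(_ _ yf); rewrite (negPf yF).
apply/negP: (IHF z s); move: cyc; rewrite with_rootE /cycle_at.
move=> /and5P[-> w -> -> ->]; rewrite !andbT.
elim: s z w es => [|[f a] s IHs] z //=.
rewrite !inE negb_or eq_sym => /and3P[/orP[/eqP ->|fF] -> w] /andP[nfe es].
  by rewrite eqxx in nfe.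
by rewrite fF IHs.
Qed.

Lemma grown_rooted_subtree G F : wf_mgraph G -> grown G F ->
  rooted_subtree G (with_root G F).
Proof.
move=> wfG gF; rewrite /rooted_subtree; split.
- rewrite with_rootE; split=> /=.
  + by apply: vset_verts => //; apply: grown_edges.
  + exact: grown_edges.
  by move=> e; apply: ends_vset.
- by rewrite with_rootE rt_vset.
by split; [apply: grown_connected | apply: grown_acyclic].
Qed.

(** Take a largest grown set [F] inside [S.2]. A walk in [S] cannot leave its vertices, since the
    leaving edge could be attached, so [F] spans [S.1]. A further edge of [S] would close a cycle
    with a simple path of [F]. *)
Lemma rooted_subtree_grown G S : wf_mgraph G -> rooted_subtree G S ->
  S = with_root G S.2 /\ grown G S.2.
Proof.
case=> _ _ pairs [[sV sE endsS] rS [conS acS]].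
have [F [gF sF maxF]] : exists F, [/\ grown G F, F \subset S.2
    & forall F', grown G F' -> F' \subset S.2 -> (#|F'| <= #|F|)%N].
  pose P F := `[< grown G F >] && (F \subset S.2).
  have P0 : P set0 by rewrite /P sub0set andbT; apply/asboolP/grown0.
  case: (arg_maxnP (fun F : {set E} => #|F|) P0) => F /andP[/asboolP gF sF] maxF.
  by exists F; split=> // F' gF' sF'; apply: maxF; rewrite /P sF' andbT; apply/asboolP.
have vFS : vset G F \subset S.1.
  rewrite vsetE subUset sub1set rS; apply/bigcupsP => e eF.
  by apply: endsS; apply: (subsetP sF).
have walkF x s : x \in vset G F -> walk (as_graph G S) x s -> walk_end x s \in vset G F.
  elim: s x => [|[e y] s IHs] x //= xF /and3P[eS /eqP ends_e].
  suff yF : y \in vset G F by apply: IHs.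
  apply/negPn/negP => yF.
  have := maxF _ (grownU1 gF (subsetP sE _ eS) ends_e xF yF).
  rewrite subUset sub1set eS sF => /(_ isT).
  by rewrite cardsU1 (notin_leaf ends_e yF) ltnn.
have vF : vset G F = S.1.
  apply/eqP; rewrite eqEsubset vFS; apply/subsetP => v vS.
  have [s ws <-] := conS _ _ rS vS.
  by apply: walkF => //; apply: rt_vset.
suff FS : F = S.2 by rewrite -FS; split=> //; rewrite with_rootE vF FS; case: (S).
apply/eqP; rewrite eqEsubset sF; apply/subsetP => e eS; apply/negPn/negP => eF.
have [x [y ends_e]] := pairs e (subsetP sE _ eS).
have /subsetP eV := endsS e eS; rewrite -vF ends_e in eV.
have xF : x \in vset G F by apply: eV; rewrite set21.
have yF : y \in vset G F by apply: eV; rewrite set22.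
have [s ws es] : reachable (as_graph G (with_root G F)) y x.
  by apply: (grown_connected gF); rewrite with_rootE.
have [s' /[dup] simp' /andP[ws' us'] es'] := walk_shorten ws.
have es'F : e \notin unzip1 s'.
  by apply: contra eF => /(walk_edges ws'); rewrite with_rootE.
apply/negP: (acS x ((e, y) :: s')); rewrite /cycle_at /= eS ends_e eqxx es'F.
rewrite (simple_path_uniq_edges simp') [walk_end x _](_ : _ = walk_end y s') // es' es eqxx.
have -> : walk (as_graph G S) y s'.
  have : walk (as_graph G (with_root G F)) y s' := ws'.
  by apply: walk_sub; rewrite with_rootE.
by rewrite negbK; move: us' => /= ->.
Qed.

End Growth.

(** * Contraction and min-max subtrees *)

Lemma setU_disjointK (E : finType) (A B : {set E}) :
  [disjoint A & B] -> (A :|: B) :\: A = B.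
Proof.
by move=> dAB; rewrite setDUl setDv set0U; apply/setDidPl; rewrite disjoint_sym.
Qed.

Lemma setUD_sub (E : finType) (A B : {set E}) : A \subset B -> A :|: (B :\: A) = B.
Proof. by move=> sAB; rewrite setDE setUIr setUCr setIT (setUidPr sAB). Qed.

Section Contraction.
Variables (R : realType) (V E : finType).
Implicit Types (G H : rooted_mgraph R V E) (F T X Y Z M : {set E}).

Definition quot G T := contract G (with_root G T).

Lemma edges_quot G T : edges (quot G T) = edges G :\: T.
Proof. by rewrite /quot with_rootE. Qed.

Lemma vset_quot G T X :
  vset (quot G T) X = rt G |: (vset G (T :|: X) :\: vset G T).
Proof.
rewrite /quot with_rootE; apply/setP => v; apply/vsetP/idP => [[->|[e eX]]|].
- by rewrite setU11.
- move=> /imsetP[a ae ->] /=; case: ifPn => aT; first by rewrite setU11.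
  rewrite !inE aT; apply/orP; right.
  by apply: (subsetP (ends_vset G _)) ae; rewrite inE eX orbT.
rewrite in_setU1 => /orP[/eqP->|]; first by left.
rewrite inE => /andP[vT /vsetP[vr|[e]]]; first by rewrite vr rt_vset in vT.
rewrite inE => /orP[eT|eX] ve.
  by rewrite (subsetP (ends_vset G eT)) in vT.
by right; exists e => //; apply/imsetP; exists v => //=; rewrite (negPf vT).
Qed.

Lemma ends_quot G T e x y : ends G e = [set x; y] ->
  ends (quot G T) e = [set (if x \in vset G T then rt G else x);
                           (if y \in vset G T then rt G else y)].
Proof. by rewrite /quot with_rootE /= => ->; rewrite imsetU1 imset_set1. Qed.

Lemma wf_quot G T : wf_mgraph G -> wf_mgraph (quot G T).
Proof.
move=> [rG endsG pairs]; split.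
- by rewrite /quot /= setU11.
- rewrite /quot with_rootE => e /=; rewrite inE => /andP[_ /endsG/subsetP sub].
  apply/subsetP => _ /imsetP[a /sub aG ->]; case: ifPn => aT; rewrite !inE ?eqxx //.
  by rewrite aT aG orbT.
move=> e; rewrite edges_quot inE => /andP[_ /pairs[x [y exy]]].
by rewrite (ends_quot T exy); do 2!eexists.
Qed.

Lemma grown_quot_sub G T X : wf_mgraph G -> grown G T -> grown (quot G T) X ->
  grown G (T :|: X) /\ [disjoint T & X].
Proof.
move=> [_ _ pairs] gT; elim=> [|{}X e x y _ [gX dX] eG ends_e xX yX].
  by rewrite setU0 disjoint_sym disjoints_subset sub0set.
move: eG; rewrite edges_quot inE => /andP[eT eG].
split; last first.
  rewrite disjoint_sym disjoints_subset subUset sub1set inE eT.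
  by rewrite -disjoints_subset disjoint_sym.
rewrite vset_quot in xX yX.
have yr : y != rt G by apply: contraNneq yX => ->; rewrite setU11.
pose phi v := if v \in vset G T then rt G else v.
(* The ends of an edge of the quotient are images under [phi] of its ends in [G]. The new end [y] is
   not the contracted root, so its preimage lies outside [T] and is [y] itself. *)
have [a [b [eab phia phib]]] :
    exists a b, [/\ ends G e = [set a; b], phi a = x & phi b = y].
  have [a [b eab]] := pairs e eG.
  have := ends_quot T eab; rewrite ends_e -/(phi a) -/(phi b) => Exy.
  have xy : x != y by apply: contraNneq yX => <-.
  have : x \in [set phi a; phi b] by rewrite -Exy set21.
  have : y \in [set phi a; phi b] by rewrite -Exy set22.
  rewrite !inE => /orP[]/eqP Ey /orP[]/eqP Ex.
  - by rewrite Ex Ey eqxx in xy.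
  - by exists b, a; rewrite setUC.
  - by exists a, b.
  by rewrite Ex Ey eqxx in xy.
have bT : b \notin vset G T.
  by apply: contraNN yr => bT; rewrite -phib /phi bT.
have b_y : b = y by rewrite -phib /phi (negPf bT).
rewrite setUCA; apply: (grownU1 gX eG eab).
  have [aT|aT] := boolP (a \in vset G T).
    by apply: (subsetP (vsetS G _)) aT; apply: subsetUl.
  move: xX; rewrite -phia /phi (negPf aT) !inE aT /= => /predU1P[ar|//].
  by rewrite ar rt_vset in aT.
by move: yX; rewrite -b_y !inE (negPf bT) negb_or => /andP[].
Qed.

(** A growth of [T :|: X] may interleave edges of [T] and [X], so it cannot be replayed in the
    quotient. The edges of [X] are put in a new order instead: each time, [grown_step] finds one
    that leaves the part reached so far. *)
Lemma grown_quot G T X : wf_mgraph G -> grown G T -> [disjoint T & X] ->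
  grown G (T :|: X) -> grown (quot G T) X.
Proof.
move=> wfG gT dX gX.
apply: (@set_extend_ind _ (grown (quot G T)) set0); [exact: grown0|exact: sub0set|].
move=> Z _ pZX gZ.
have [gTZ dZ] := grown_quot_sub wfG gT gZ.
have notT e : e \in X -> e \notin T.
  by move=> eX; apply/negP => eT; have /pred0P/(_ e) := dX; rewrite /= eT eX.
have pTZ : T :|: Z \proper T :|: X.
  case/properP: pZX => sZX [e eX eZ]; apply/properP; split; first exact: setUS.
  by exists e; rewrite !inE ?eX ?orbT // negb_or (notT e eX) eZ.
have [e [x [y [eX ends_e xT yT]]]] := grown_step gTZ gX pTZ.
have yT' : y \notin vset G T.
  by apply: contra yT; apply/subsetP/vsetS/subsetUl.
move: eX; rewrite !inE negb_or => /andP[/andP[eT eZ]].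
rewrite (negPf eT) /= => eX; exists e; first by rewrite inE eZ eX.
apply: (grownU1 gZ _ (ends_quot T ends_e)).
- rewrite edges_quot inE eT.
  by apply: (subsetP (grown_edges gX)); rewrite inE eX orbT.
- rewrite vset_quot; case: ifPn => xT'; first by rewrite setU11.
  by rewrite !inE xT' xT orbT.
rewrite (negPf yT') vset_quot !inE (negPf yT) andbF orbF.
by apply: contra yT' => /eqP->; apply: rt_vset.
Qed.

(** * Prizes and costs of edge sets, and densities in contractions *)

Definition pz G F : R := \sum_(v in vset G F) prize G v.
Definition ct G F : R := \sum_(e in F) cost G e.

Lemma sprizeE G F : sprize G (with_root G F) = pz G F.
Proof. by rewrite with_rootE. Qed.

Lemma scostE G F : scost G (with_root G F) = ct G F.
Proof. by rewrite with_rootE. Qed.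

Lemma sum_prize_quot G T (A : {set V}) : vset G T \subset A ->
  \sum_(v in rt G |: (A :\: vset G T)) prize (quot G T) v =
  \sum_(v in A) prize G v - pz G T.
Proof.
move=> sTA; rewrite big_setU1 ?inE ?rt_vset //= eqxx add0r.
rewrite [in RHS](big_setID (vset G T)) /= (setIidPr sTA) addrC addrK.
apply: eq_bigr => v; rewrite inE => /andP[vT _].
by case: eqP vT => // ->; rewrite rt_vset.
Qed.

Lemma pz_quot G T X : pz (quot G T) X = pz G (T :|: X) - pz G T.
Proof.
by rewrite /pz vset_quot sum_prize_quot //; apply/vsetS/subsetUl.
Qed.

Lemma total_prize_quot G T : vset G T \subset verts G ->
  total_prize (quot G T) = total_prize G - pz G T.
Proof.
move=> sT; rewrite /total_prize {1}/quot with_rootE /=; exact: sum_prize_quot.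
Qed.

Lemma ctD G T X : T \subset X -> ct G (X :\: T) = ct G X - ct G T.
Proof.
by move=> sTX; rewrite /ct [in RHS](big_setID T) /= (setIidPr sTX) addrC addrK.
Qed.

Lemma ctU G T X : [disjoint T & X] -> ct G (T :|: X) = ct G T + ct G X.
Proof.
by move=> dTX; rewrite -[X in _ + ct G X](setU_disjointK dTX) ctD ?subsetUl // addrC subrK.
Qed.

(** The properties of an instance that are inherited by contractions and by min-max subtrees taken
    as graphs; simplicity is not among them. *)
Definition admissible G : Prop :=
  [/\ wf_mgraph G, forall e, e \in edges G -> 0 < cost G e
    & forall v, v \in verts G -> 0 <= prize G v].

Lemma admissible_quot G T : admissible G -> admissible (quot G T).
Proof.
move=> [wfG cG pG]; split; first exact: wf_quot.
  by move=> e; rewrite edges_quot inE => /andP[_ /cG].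
by move=> v /=; case: ifP => // vr; rewrite !inE vr /= => /andP[_ /pG].
Qed.

Lemma ct_ge0 G F : admissible G -> F \subset edges G -> 0 <= ct G F.
Proof.
by move=> [_ cG _] sF; apply: sumr_ge0 => e /(subsetP sF)/cG/ltW.
Qed.

Lemma ct_gt0 G F : admissible G -> F \subset edges G -> F != set0 -> 0 < ct G F.
Proof.
move=> admG sF /set0Pn[e eF]; have [_ cG _] := admG.
rewrite /ct (bigD1 e) //= ltr_wpDr ?cG ?(subsetP sF) //.
by apply: sumr_ge0 => f /andP[/(subsetP sF)/cG/ltW].
Qed.

Lemma ctS G F F' : admissible G -> F \subset F' -> F' \subset edges G ->
  ct G F <= ct G F'.
Proof.
move=> admG sFF' sF'; rewrite -subr_ge0 -ctD //; apply: ct_ge0 => //.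
exact: subset_trans (subsetDl _ _) sF'.
Qed.

Lemma pzS_vset G F F' : admissible G -> F' \subset edges G ->
  vset G F \subset vset G F' -> pz G F <= pz G F'.
Proof.
move=> [wfG _ pG] sF' sFF'; rewrite /pz [leRHS](big_setID (vset G F)) /=.
rewrite (setIidPr sFF') lerDl; apply: sumr_ge0 => v; rewrite inE => /andP[_ vF'].
by apply/pG/(subsetP (vset_verts wfG sF')).
Qed.

Lemma pzS G F F' : admissible G -> F \subset F' -> F' \subset edges G ->
  pz G F <= pz G F'.
Proof. by move=> admG sFF' sF'; apply: pzS_vset => //; apply: vsetS. Qed.

Lemma pz_ge0 G F : admissible G -> F \subset edges G -> 0 <= pz G F.
Proof.
by move=> [wfG _ pG] sF; apply: sumr_ge0 => v /(subsetP (vset_verts wfG sF))/pG.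
Qed.

Lemma pz_le_total G F : admissible G -> F \subset edges G -> pz G F <= total_prize G.
Proof.
move=> admG sF; have [wfG _ pG] := admG.
rewrite /total_prize (big_setID (vset G F)) /= (setIidPr (vset_verts wfG sF)) lerDl.
by apply: sumr_ge0 => v; rewrite inE => /andP[_ /pG].
Qed.

(* The min-max subtrees M of G/T of density d, expressed through the rooted
   subtrees of G that contain T. *)
Record tight G T M (d : R) : Prop := Tight {
  tight_grown : grown G (T :|: M);
  tight_disjoint : [disjoint T & M];
  tight_neq0 : M != set0;
  tight_gt0 : 0 < d;
  tight_density : pz G (T :|: M) - pz G T = d * ct G M;
  tight_max : forall X, grown G X -> T \subset X ->
    pz G X - pz G T <= d * (ct G X - ct G T);
  tight_min : forall X, grown G X -> T \proper X -> X \proper T :|: M ->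
    pz G X - pz G T < d * (ct G X - ct G T) }.

Lemma density_quot G T X : grown G X -> T \subset X ->
  density (quot G T) (with_root (quot G T) (X :\: T)) =
  if X == T then 0 else (pz G X - pz G T) / (ct G X - ct G T).
Proof.
move=> gX sTX; rewrite /density sprizeE scostE with_rootE /=.
have -> : (X :\: T == set0) = (X == T) by rewrite setD_eq0 eqEsubset sTX andbT.
case: ifP => // _; rewrite pz_quot [ct _ _](_ : _ = ct G (X :\: T)) //.
by rewrite ctD // setUD_sub.
Qed.

Lemma grown_quotD G T X : wf_mgraph G -> grown G T -> grown G X -> T \subset X ->
  grown (quot G T) (X :\: T).
Proof.
move=> wfG gT gX sTX; apply: grown_quot => //.
  by rewrite disjoint_sym; apply/setDidPl; rewrite setDDl setUid.
by rewrite setUD_sub.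
Qed.

(** A subtree that gains prize makes the maximum density positive, so the min-max subtree is not
    trivial and positive costs allow the quotients to be cleared. A proper part of the same density
    would itself have maximum density, against inclusion-minimality; this makes [tight_min]
    strict. *)
Lemma min_max_tight G T S : admissible G -> grown G T ->
  (exists X, [/\ grown G X, T \subset X & pz G T < pz G X]) ->
  min_max_subtree (quot G T) S ->
  exists M d, S = with_root (quot G T) M /\ tight G T M d.
Proof.
move=> admG gT [W [gW sTW ltW]] [[rS maxS] minS].
have [wfG _ _] := admG; have wfQ := wf_quot T wfG.
have [ES gM] := rooted_subtree_grown wfQ rS.
set M := S.2 in ES gM; pose d := density (quot G T) S.
have [gTM dTM] := grown_quot_sub wfG gT gM.
have TMD : (T :|: M) :\: T = M.
  exact: setU_disjointK.
have ct_gt X : grown G X -> T \proper X -> 0 < ct G X - ct G T.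
  move=> gX pTX; rewrite -ctD ?proper_sub //; apply: ct_gt0 => //.
    exact: subset_trans (subsetDl _ _) (grown_edges gX).
  by rewrite setD_eq0 proper_subn.
have rX X : grown G X -> T \subset X ->
    rooted_subtree (quot G T) (with_root (quot G T) (X :\: T)).
  by move=> gX sTX; apply/grown_rooted_subtree/grown_quotD.
have maxX X : grown G X -> T \proper X -> (pz G X - pz G T) / (ct G X - ct G T) <= d.
  move=> gX pTX; have := maxS _ (rX X gX (proper_sub pTX)).
  by rewrite density_quot ?proper_sub //; case: eqP pTX => // ->; rewrite properxx.
have pTW : T \proper W.
  rewrite properEneq sTW andbT; apply: contraTneq ltW => ->.
  by rewrite ltxx.
have d_gt0 : 0 < d.
  apply: lt_le_trans (maxX W gW pTW); rewrite divr_gt0 ?subr_gt0 //.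
  by rewrite -subr_gt0 ct_gt.
have dE : d = if T :|: M == T then 0 else
    (pz G (T :|: M) - pz G T) / (ct G (T :|: M) - ct G T).
  by rewrite -density_quot ?subsetUl // TMD -ES.
have neqT : T :|: M != T.
  by apply/eqP => eqT; move: d_gt0; rewrite dE eqT eqxx ltxx.
have pTM : T \proper T :|: M by rewrite properEneq eq_sym neqT subsetUl.
have M_neq0 : M != set0 by apply: contraNneq neqT => ->; rewrite setU0.
exists M, d; split=> //; split=> //.
- rewrite dE (negPf neqT) ctU // addrAC subrr add0r divfK //.
  by have := ct_gt _ gTM pTM; rewrite ctU // addrAC subrr add0r => /lt0r_neq0.
- move=> X gX sTX; have [->|neX] := eqVneq X T; first by rewrite !subrr mulr0.
  have pTX : T \proper X by rewrite properEneq eq_sym neX.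
  by rewrite -ler_pdivrMr ?ct_gt ?maxX.
move=> X gX pTX pXM; rewrite -ltr_pdivrMr ?ct_gt // lt_neqAle maxX // andbT.
apply/eqP => dX; have sXM : X :\: T \subset M.
  by rewrite -TMD; apply: setSD; apply: proper_sub.
have Xmax : max_density (quot G T) (with_root (quot G T) (X :\: T)).
  split; first exact/rX/proper_sub.
  move=> S' rS'; apply: le_trans (maxS _ rS') _; rewrite -/d -dX density_quot ?proper_sub //.
  by case: eqP pTX => // ->; rewrite properxx.
have := minS _ Xmax; rewrite ES !with_rootE /= vsetS // sXM => /(_ isT isT)[_ XM].
by move: pXM; rewrite -XM setUD_sub ?proper_sub // properxx.
Qed.

Lemma min_max_exists G T : admissible G -> grown G T ->
  exists S, min_max_subtree (quot G T) S.
Proof.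
move=> admG gT; have [wfG _ _] := admG; have wfQ := wf_quot T wfG.
pose dens F := density (quot G T) (with_root (quot G T) F).
pose P F := `[< grown (quot G T) F >].
have P0 : P set0 by apply/asboolP/grown0.
case: (@arg_maxP _ _ _ set0 P dens P0) => F0 /asboolP gF0 maxF0.
(* Among the sets of maximum density one of least cardinality is taken; it is in particular minimal
   for inclusion. *)
pose Q F := P F && (dens F == dens F0).
have Q0 : Q F0 by rewrite /Q eqxx andbT; apply/asboolP.
case: (arg_minnP (fun F : {set E} => #|F|) Q0) => F /andP[/asboolP gF /eqP dF] minF.
exists (with_root (quot G T) F); split; first split.
- exact: grown_rooted_subtree.
- move=> S /(rooted_subtree_grown wfQ)[ES gS]; rewrite ES -/(dens F) dF.
  by apply: maxF0; apply/asboolP.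
move=> S [/(rooted_subtree_grown wfQ)[ES gS] maxS] _.
rewrite with_rootE /= => sSF; rewrite ES -with_rootE; suff -> : S.2 = F by [].
apply/eqP; rewrite eqEcard sSF minF //; apply/andP; split; first exact/asboolP.
rewrite eq_le; apply/andP; split; first by apply: maxF0; apply/asboolP.
by rewrite /dens -ES; apply: maxS; apply: grown_rooted_subtree.
Qed.

End Contraction.

(** * The order of a rooted tree *)

Section TreeOrder.
Variables (R : realType) (V E : finType).
Implicit Types (G H : rooted_mgraph R V E) (F T X Y Z M : {set E}).

(* [pa e] and [ch e] are the ends of [e] nearer to and farther from the root of
   the tree Y, and [rp v] is the edge set of the path from the root to [v]. *)
Record tree_order G Y (pa ch : E -> V) (rp : V -> {set E}) : Prop := TreeOrder {
  to_ends : forall e, e \in Y -> ends G e = [set pa e; ch e];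
  to_pa : forall e, e \in Y -> pa e \in vset G Y;
  to_neq : forall e, e \in Y -> pa e != ch e;
  to_ch_rt : forall e, e \in Y -> ch e != rt G;
  to_inj : {in Y &, injective ch};
  to_rp_rt : rp (rt G) = set0;
  to_rp : forall e, e \in Y -> rp (ch e) = e |: rp (pa e);
  to_rp_grown : forall v, v \in vset G Y ->
    [/\ grown G (rp v), rp v \subset Y & v \in vset G (rp v)];
  to_path : forall v, v \in vset G Y -> exists s,
    [/\ simple_path G (rt G) s, walk_end (rt G) s = v,
        {subset unzip2 s <= vset G Y} & [set e in unzip1 s] = rp v];
  to_grown : forall F, F \subset Y ->
    (forall e, e \in F -> pa e \in rt G |: ch @: F) -> grown G F;
  to_rp_sub : forall F, F \subset Y ->
    (forall e, e \in F -> pa e \in rt G |: ch @: F) ->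
    forall v, v \in rt G |: ch @: F -> rp v \subset F }.

Lemma closed_vset G Y pa ch rp F : tree_order G Y pa ch rp -> F \subset Y ->
  (forall e, e \in F -> pa e \in rt G |: ch @: F) -> vset G F = rt G |: ch @: F.
Proof.
move=> tO sFY clF; apply/setP => v; apply/vsetP/idP => [[->|[e eF]]|].
- by rewrite setU11.
- rewrite (to_ends tO (subsetP sFY _ eF)) !inE => /orP[]/eqP->.
    by rewrite -in_setU1 clF.
  by rewrite imset_f ?orbT.
rewrite in_setU1 => /orP[/eqP->|/imsetP[e eF ->]]; first by left.
by right; exists e; rewrite // (to_ends tO (subsetP sFY _ eF)) set22.
Qed.

Lemma tree_orderE G Y : grown G Y -> exists pa ch rp, tree_order G Y pa ch rp.
Proof.
elim=> [|{}Y e x y gY [pa [ch [rp tO]]] eG ends_e xY yY].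
  exists (fun=> rt G), (fun=> rt G), (fun=> set0); split=> //.
  - by move=> e; rewrite inE.
  - by move=> e; rewrite inE.
  - by move=> e; rewrite inE.
  - by move=> e; rewrite inE.
  - by move=> e f; rewrite inE.
  - by move=> e; rewrite inE.
  - by move=> v; rewrite vset0 inE => /eqP->; split; rewrite ?rt_vset //; apply: grown0.
  - move=> v; rewrite vset0 inE => /eqP->; exists [::]; split=> //.
  - by move=> F; rewrite subset0 => /eqP-> _; apply: grown0.
  by move=> F _ _ v _; apply: sub0set.
have eY := notin_leaf ends_e yY.
have neY f : f \in Y -> (f == e) = false by move=> fY; apply: contraNF eY => /eqP<-.
have neV v : v \in vset G Y -> (v == y) = false.
  by move=> vY; apply: contraNF yY => /eqP<-.
have vY' : vset G (e |: Y) = y |: vset G Y := vset_leaf ends_e xY.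
have chY f : f \in Y -> ch f \in vset G Y.
  move=> fY; apply: (subsetP (ends_vset G fY)).
  by rewrite (to_ends tO fY) set22.
have xy : x != y by apply/negbT/neV.
have rty : (rt G == y) = false by apply/neV/rt_vset.
pose pa' f := if f == e then x else pa f.
pose ch' f := if f == e then y else ch f.
pose rp' v := if v == y then e |: rp x else rp v.
have pa'e : pa' e = x by rewrite /pa' eqxx.
have ch'e : ch' e = y by rewrite /ch' eqxx.
have pa'E f : f \in Y -> pa' f = pa f by move=> fY; rewrite /pa' neY.
have ch'E f : f \in Y -> ch' f = ch f by move=> fY; rewrite /ch' neY.
(* The new vertex [y] is a leaf and the parent end of no edge of [Y], so deleting [e] keeps a set
   closed under passing to the parent edge. *)
have closedD F : F \subset e |: Y ->
    (forall f, f \in F -> pa' f \in rt G |: ch' @: F) ->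
    [/\ F :\ e \subset Y,
      forall v, v != y -> v \in rt G |: ch' @: F -> v \in rt G |: ch @: (F :\ e) &
      forall f, f \in F :\ e -> pa f \in rt G |: ch @: (F :\ e)].
  move=> sF clF; have sF' : F :\ e \subset Y by rewrite subDset.
  have sub v : v != y -> v \in rt G |: ch' @: F -> v \in rt G |: ch @: (F :\ e).
    move=> vy; rewrite !in_setU1 => /orP[->//|/imsetP[f fF vf]]; apply/orP; right.
    have fe : f != e by apply: contraNneq vy => fe; rewrite vf fe ch'e.
    have fF' : f \in F :\ e by rewrite !inE fe.
    by rewrite vf ch'E ?imset_f // (subsetP sF').
  split=> // f fF; have fY := subsetP sF' f fF.
  rewrite -(pa'E f fY); apply: sub; first by rewrite pa'E // neV // (to_pa tO).
  by apply: clF; move: fF; rewrite inE => /andP[].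
exists pa', ch', rp'; split.
- move=> f /setU1P[->|fY]; first by rewrite pa'e ch'e.
  by rewrite pa'E // ch'E // (to_ends tO).
- move=> f; rewrite vY' => /setU1P[->|fY]; first by rewrite pa'e inE xY orbT.
  by rewrite pa'E // inE (to_pa tO) // orbT.
- move=> f /setU1P[->|fY]; first by rewrite pa'e ch'e.
  by rewrite pa'E // ch'E // (to_neq tO).
- move=> f /setU1P[->|fY]; first by rewrite ch'e eq_sym rty.
  by rewrite ch'E // (to_ch_rt tO).
- move=> f g /setU1P[->|fY] /setU1P[->|gY'] //.
  + by rewrite ch'e ch'E // => yg; rewrite yg chY in yY.
  + by rewrite ch'e ch'E // => yg; rewrite -yg chY in yY.
  by rewrite !ch'E //; apply: (to_inj tO).
- by rewrite /rp' rty (to_rp_rt tO).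
- move=> f /setU1P[->|fY]; first by rewrite ch'e pa'e /rp' eqxx (negPf xy).
  by rewrite pa'E // ch'E // /rp' !neV ?chY ?(to_pa tO) // (to_rp tO).
- have [gx sx vx] := to_rp_grown tO xY.
  have sY : Y \subset e |: Y := subsetUr _ _.
  have yrx : y \notin vset G (rp x) by apply: contra yY; apply/subsetP/vsetS.
  move=> v; rewrite vY' => /setU1P[->|vY]; rewrite /rp'.
    rewrite eqxx; split.
    + exact: (grownU1 gx eG ends_e vx yrx).
    + exact: setUS.
    by rewrite (vset_leaf ends_e vx) setU11.
  rewrite neV //; have [gv sv vv] := to_rp_grown tO vY.
  by split=> //; apply: subset_trans sY.
- move=> v; rewrite vY' => /setU1P[->|vY]; rewrite /rp'; last first.
    rewrite neV //; have [s [ss es vs rs]] := to_path tO vY; exists s; split=> //.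
    by move=> w /vs; rewrite inE orbC => ->.
  rewrite eqxx; have [s [/andP[ws us] es vs rs]] := to_path tO xY.
  exists (rcons s (e, y)); split.
  + rewrite /simple_path -cats1 walk_cat ws /= es eG ends_e eqxx /=.
    rewrite /unzip2 map_cat /= cats1 rcons_uniq mem_rcons inE rty /=.
    move: us => /= /andP[-> ->]; rewrite andbT /=.
    by apply: contra yY => /vs.
  + by rewrite -cats1 walk_end_cat.
  + move=> w; rewrite /unzip2 map_rcons mem_rcons inE => /predU1P[->|/vs].
      by rewrite setU11.
    by rewrite inE orbC => ->.
  rewrite -rs; apply/setP => f.
  by rewrite /unzip1 map_rcons !inE mem_rcons inE.
- move=> F sF clF; have [sF' subF clF'] := closedD F sF clF.
  have gF' := to_grown tO sF' clF'.
  have [eF|eF] := boolP (e \in F); last first.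
    by rewrite (_ : F = F :\ e) //; apply/esym/setDidPl; rewrite disjoint_sym disjoints1.
  rewrite -(setD1K eF); apply: (grownU1 gF' eG ends_e).
    rewrite (closed_vset tO sF' clF'); apply: subF => //.
    by rewrite -pa'e; apply: clF.
  by apply: contra yY; apply/subsetP/vsetS.
move=> F sF clF v vF; have [sF' subF clF'] := closedD F sF clF.
have sub := to_rp_sub tO sF' clF'.
rewrite /rp'; have [vy|vy] := eqVneq v y; last first.
  by apply: subset_trans (subD1set F e); apply: sub; apply: subF.
have eF : e \in F.
  move: vF; rewrite vy in_setU1 eq_sym rty /= => /imsetP[f fF yf].
  have /setU1P[<-//|fY] := subsetP sF f fF.
  by rewrite yf ch'E // chY in yY.
rewrite -(setD1K eF); apply: setUS; apply: sub; apply: subF => //.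
by rewrite -pa'e; apply: clF.
Qed.

Lemma big_setUI (I : finType) (A B : {set I}) (F : I -> R) :
  \sum_(i in A :|: B) F i + \sum_(i in A :&: B) F i =
  \sum_(i in A) F i + \sum_(i in B) F i.
Proof.
rewrite (big_setID A) /= setUK setDUl setDv set0U -addrA; congr (_ + _).
by rewrite [RHS](big_setID A) /= setIC addrC.
Qed.

Section Tree.
Variables (G : rooted_mgraph R V E) (Y : {set E}).
Variables (pa ch : E -> V) (rp : V -> {set E}).
Hypothesis tO : tree_order G Y pa ch rp.

(** The root and the farther ends of the edges of [F] are distinct, hence as many as the vertices of
    [F], so they are all of them. *)
Lemma grown_closed F : F \subset Y -> grown G F ->
  forall e, e \in F -> pa e \in rt G |: ch @: F.
Proof.
move=> sFY gF e eF.
have endsF f : f \in F -> [set pa f; ch f] \subset vset G F.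
  by move=> fF; rewrite -(to_ends tO (subsetP sFY _ fF)); apply: ends_vset.
suff -> : rt G |: ch @: F = vset G F by apply: (subsetP (endsF e eF)); rewrite set21.
apply/eqP; rewrite eqEcard; apply/andP; split.
  rewrite subUset sub1set rt_vset; apply/subsetP => _ /imsetP[f fF ->].
  by apply: (subsetP (endsF f fF)); rewrite set22.
rewrite card_vset // cardsU1 card_in_imset; last first.
  by move=> f g fF gF'; apply: (to_inj tO); apply: (subsetP sFY).
rewrite (_ : rt G \notin _) //; apply/imsetP => -[f fF rf].
by have := to_ch_rt tO (subsetP sFY _ fF); rewrite -rf eqxx.
Qed.

Lemma grown_vsetE F : F \subset Y -> grown G F -> vset G F = rt G |: ch @: F.
Proof. by move=> sFY gF; apply: closed_vset tO _ _ => //; apply: grown_closed. Qed.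

Lemma tree_grownU F F' : F \subset Y -> F' \subset Y ->
  grown G F -> grown G F' -> grown G (F :|: F').
Proof.
move=> sF sF' gF gF'; apply: (to_grown tO); first by rewrite subUset sF.
by move=> e; rewrite imsetU setUUr !inE -!in_setU1 => /orP[]
  /(grown_closed _ _) -> //; rewrite orbT.
Qed.

(** A vertex other than the root has only one edge towards the root ([to_inj]), so a vertex reached
    by both sets is reached through a common edge. *)
Lemma tree_grownI F F' : F \subset Y -> F' \subset Y ->
  grown G F -> grown G F' -> grown G (F :&: F').
Proof.
move=> sF sF' gF gF'; apply: (to_grown tO); first by rewrite subIset ?sF.
move=> e; rewrite inE => /andP[/(grown_closed sF gF) e1 /(grown_closed sF' gF')].
move: e1; rewrite !in_setU1 => /orP[->//|/imsetP[f fF ef]] /orP[->//|/imsetP[g gF'' eg]].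
have fg : f = g.
  by apply: (to_inj tO); [apply: (subsetP sF)|apply: (subsetP sF')|rewrite -ef -eg].
by rewrite ef imset_f ?orbT // inE fF fg gF''.
Qed.

(** Each vertex but the root is charged to the edge above it. This makes the prize additive over
    edges, whence the modularity [tree_pz_mod]. *)
Lemma tree_pzE F : F \subset Y -> grown G F ->
  pz G F = prize G (rt G) + \sum_(e in F) prize G (ch e).
Proof.
move=> sF gF; rewrite /pz (grown_vsetE sF gF) big_setU1 /=.
  rewrite big_imset // => f g fF gF'; apply: (to_inj tO); exact: (subsetP sF).
apply/imsetP => -[f fF rf].
by have := to_ch_rt tO (subsetP sF _ fF); rewrite -rf eqxx.
Qed.

Lemma tree_pz_mod F F' : F \subset Y -> F' \subset Y ->
  grown G F -> grown G F' ->
  pz G (F :|: F') + pz G (F :&: F') = pz G F + pz G F'.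
Proof.
move=> sF sF' gF gF'; rewrite !tree_pzE //.
- by rewrite addrACA big_setUI addrACA.
- by rewrite subIset ?sF.
- exact: tree_grownI.
- by rewrite subUset sF.
exact: tree_grownU.
Qed.

Lemma ct_mod F F' : ct G (F :|: F') + ct G (F :&: F') = ct G F + ct G F'.
Proof. exact: big_setUI. Qed.

Lemma rp_sub F e : F \subset Y -> grown G F -> e \in F -> rp (ch e) \subset F.
Proof.
move=> sF gF eF; apply: (to_rp_sub tO sF (grown_closed sF gF)).
by rewrite in_setU1 imset_f ?orbT.
Qed.

(** If the farther end of [e] were a vertex of [F], it would be reached in [F] by an edge with the
    same farther end, that is, by [e] itself. *)
Lemma tree_attachP F e : F \subset Y -> grown G F -> e \in Y :\: F ->
  (exists2 v, v \in ends G e & v \in vset G F) <-> pa e \in vset G F.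
Proof.
move=> sF gF; rewrite inE => /andP[eF eY]; rewrite (to_ends tO eY).
split=> [[v]|paF]; last by exists (pa e); rewrite ?set21.
rewrite !inE => /orP[]/eqP-> //; rewrite {1}(grown_vsetE sF gF) in_setU1.
rewrite (negPf (to_ch_rt tO eY)) /= => /imsetP[f fF cf].
by move: eF; rewrite (to_inj tO eY (subsetP sF _ fF) cf) fF.
Qed.

Lemma tree_attach_grown F e : F \subset Y -> grown G F -> e \in Y :\: F ->
  grown G (e |: F) <-> pa e \in vset G F.
Proof.
move=> sF gF; rewrite inE => /andP[eF eY].
have sF' : e |: F \subset Y by rewrite subUset sub1set eY.
split=> [gF'|paF].
  have := grown_closed sF' gF' (setU11 e F).
  rewrite (grown_vsetE sF gF) imsetU1 !inE (negPf (to_neq tO eY)).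
  by [].
apply: (to_grown tO sF') => f /setU1P[->|fF].
  move: paF; rewrite (grown_vsetE sF gF); apply/subsetP/setUS/imsetS/subsetUr.
by apply: subsetP (grown_closed sF gF fF); apply/setUS/imsetS/subsetUr.
Qed.

End Tree.
End TreeOrder.

(** * The density-greedy algorithm on trees *)

Lemma cat_cons_split (T : Type) (a b s t : seq T) x : s ++ x :: t = a ++ b ->
  (exists t', a = s ++ x :: t' /\ t = t' ++ b) \/
  (exists s', s = a ++ s' /\ b = s' ++ x :: t).
Proof.
elim: a s => [|y a IHa] [|z s] //=.
- by move=> <-; right; exists [::].
- by move=> <-; right; exists (z :: s).
- by case=> -> ->; left; exists a.
case=> -> /IHa[[t' [-> ->]]|[s' [-> ->]]]; [left; exists t'|right; exists s']; by [].
Qed.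

Section TreeRun.
Variables (R : realType) (V E : finType).
Implicit Types (G H : rooted_mgraph R V E) (F T X Y Z M N : {set E}).

Lemma root_onlyE G : root_only G = with_root G set0.
Proof. by rewrite with_rootE vset0. Qed.

Lemma rt_ends_quot G T e :
  (rt G \in ends (quot G T) e) <-> exists2 v, v \in ends G e & v \in vset G T.
Proof.
rewrite /quot with_rootE /=; split=> [/imsetP[v ve]|[v ve vT]]; last first.
  by apply/imsetP; exists v; rewrite ?vT.
by case: ifPn => [vT _|_ rv]; exists v => //; rewrite -rv rt_vset.
Qed.

Lemma sunion_with_root G T X :
  sunion (with_root G T) (edge_sgraph G X) = with_root G (T :|: X).
Proof. by rewrite !with_rootE /sunion /= !vsetE bigcup_setU setUA. Qed.

(** * Runs on a graph whose edges form one rooted tree *)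

Variable G : rooted_mgraph R V E.
Hypotheses (admG : admissible G) (gY : grown G (edges G)).
Hypothesis vertsY : verts G = vset G (edges G).
Variables (pa ch : E -> V) (rp : V -> {set E}).
Hypothesis tO : tree_order G (edges G) pa ch rp.

Let wfG : wf_mgraph G. Proof. by case: admG. Qed.

Let gE T : grown G T -> T \subset edges G. Proof. exact: grown_edges. Qed.

Let gU T X : grown G T -> grown G X -> grown G (T :|: X).
Proof. by move=> gT gX; apply: (tree_grownU tO) => //; apply: gE. Qed.

Lemma rp_mem e : e \in edges G -> e \in rp (ch e).
Proof. by move=> eG; rewrite (to_rp tO) // setU11. Qed.

Lemma rp_edge_grown e : e \in edges G -> grown G (rp (ch e)).
Proof.
move=> eG; have [] // := to_rp_grown tO (v := ch e).
by apply: (subsetP (ends_vset G eG)); rewrite (to_ends tO eG) set22.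
Qed.

(* If two edges of M were attached to T, then M would split into the part above
   one of them and the rest, and one of these parts would be at least as dense. *)
Lemma tight_attach T M d : grown G T -> tight G T M d ->
  exists f, [/\ f \in M, grown G (f |: T),
    [set g in M | rt G \in ends (quot G T) g] = [set f] &
    forall e, e \in M -> f \in rp (ch e)].
Proof.
move=> gT tM; have gTM := tight_grown tM; have dTM := tight_disjoint tM.
have sTM := gE gTM; have sT := gE gT.
have MT e : e \in M -> e \notin T.
  by move=> eM; apply/negP => eT; have /pred0P/(_ e) := dTM; rewrite /= eT eM.
have sM : M \subset edges G by apply: subset_trans sTM; apply: subsetUr.
have MD e : e \in M -> e \in edges G :\: T by move=> eM; rewrite inE MT ?(subsetP sM).
have pTM : T \proper T :|: M.
  rewrite properEneq subsetUl andbT; apply: contra (tight_neq0 tM) => /eqP TM.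
  by rewrite -(setU_disjointK dTM) -TM setDv.
have [f fM gf] := grown_attach gT gTM pTM.
have {}fM : f \in M by move: fM; rewrite !inE; case: (f \in T).
have uniqf g : g \in M -> grown G (g |: T) -> g = f.
  move=> gM gg; apply/eqP/negPn/negP => gf'.
  (* The part of [M] at and below [f]. The edge [g] is not in it, because its path to the root
     consists of [g] and edges of [T]. *)
  pose Mf := [set h in M | f \in rp (ch h)].
  have sMf : Mf \subset M by apply/subsetP => h; rewrite inE => /andP[].
  have fMf : f \in Mf by rewrite inE fM rp_mem // (subsetP sM).
  have gMf : g \notin Mf.
    rewrite inE gM /=; apply: contra gf' => fg.
    have := subsetP (rp_sub tO (gE gg) gg (setU11 _ _)) f fg.
    by rewrite inE (negPf (MT f fM)) orbF inE eq_sym.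
  have clM := grown_closed tO sTM gTM.
  have clT := grown_closed tO sT gT.
  have weak (A B : {set E}) e : A \subset B ->
      pa e \in rt G |: ch @: A -> pa e \in rt G |: ch @: B.
    by move=> sAB; apply/subsetP/setUS; apply: imsetS.
  have g1 : grown G (T :|: Mf).
    apply: (to_grown tO); first by rewrite subUset sT (subset_trans sMf).
    move=> e /setUP[eT|]; first by apply: weak (clT e eT); apply: subsetUl.
    rewrite inE => /andP[eM fe].
    have [ef|ef] := eqVneq e f.
      have /(tree_attach_grown tO sT gT (MD f fM)) := gf.
      rewrite (grown_vsetE tO sT gT) ef; apply: weak; exact: subsetUl.
    have fpa : f \in rp (pa e).
      by move: fe; rewrite (to_rp tO) ?(subsetP sM) // inE inE eq_sym (negPf ef).
    have /setU1P[pr|/imsetP[h hTM ph]] : pa e \in rt G |: ch @: (T :|: M).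
      by apply: clM; rewrite inE eM orbT.
      by rewrite pr (to_rp_rt tO) inE in fpa.
    rewrite ph in fpa; rewrite ph in_setU1 imset_f ?orbT //.
    move: hTM; rewrite !inE fpa andbT => /orP[hT|->]; last by rewrite orbT.
    by have := subsetP (rp_sub tO sT gT hT) f fpa; rewrite (negPf (MT f fM)).
  have g2 : grown G (T :|: (M :\: Mf)).
    apply: (to_grown tO).
      by rewrite subUset sT (subset_trans (subsetDl _ _)).
    move=> e /setUP[eT|]; first by apply: weak (clT e eT); apply: subsetUl.
    rewrite inE => /andP[eMf eM].
    have /setU1P[->|/imsetP[h hTM ph]] : pa e \in rt G |: ch @: (T :|: M).
      by apply: clM; rewrite inE eM orbT.
      by rewrite setU11.
    rewrite ph in_setU1 imset_f ?orbT //.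
    move: hTM; rewrite in_setU => /orP[hT|hM]; first by rewrite inE hT.
    rewrite inE in_setD hM andbT; apply/orP; right; apply: contra eMf.
    rewrite !inE => /andP[_ fh]; rewrite eM (to_rp tO) ?(subsetP sM) // ph.
    by rewrite inE fh orbT.
  have U12 : (T :|: Mf) :|: (T :|: (M :\: Mf)) = T :|: M.
    by rewrite setUACA setUid; congr (_ :|: _); rewrite setUD_sub.
  have I12 : (T :|: Mf) :&: (T :|: (M :\: Mf)) = T.
    by rewrite -setUIr setIDA setIC setDIl setDv setI0 setU0.
  have p1 : T \proper T :|: Mf.
    by apply/properP; split; [exact: subsetUl|exists f; rewrite ?MT // inE fMf orbT].
  have p2 : T \proper T :|: (M :\: Mf).
    apply/properP; split; first exact: subsetUl.
    by exists g; rewrite ?MT // in_setU in_setD gMf gM orbT.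
  have q1 : T :|: Mf \proper T :|: M.
    apply/properP; split; first exact: setUS.
    by exists g; rewrite inE ?gM ?orbT // negb_or MT.
  have q2 : T :|: (M :\: Mf) \proper T :|: M.
    apply/properP; split; first by apply: setUS; apply: subsetDl.
    exists f; first by rewrite inE fM orbT.
    by rewrite inE negb_or MT // inE fMf.
  have := tight_min tM g1 p1 q1; have := tight_min tM g2 p2 q2.
  (* Both parts stay strictly below rate [d], but by modularity their gains and costs add up to
     those of [M], which has density exactly [d]. *)
  have := tree_pz_mod tO (gE g1) (gE g2) g1 g2.
  have := ct_mod G (T :|: Mf) (T :|: (M :\: Mf)).
  rewrite U12 I12 => c12 z12 lt2 lt1; have := tight_density tM.
  have -> : ct G M = ct G (T :|: M) - ct G T by rewrite -ctD ?subsetUl // setU_disjointK.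
  move: lt1 lt2; rewrite !mulrBr => lt1 lt2 dens.
  have : d * ct G (T :|: M) + d * ct G T =
         d * ct G (T :|: Mf) + d * ct G (T :|: (M :\: Mf)) by rewrite -!mulrDr c12.
  by lra.
exists f; split=> //.
  apply/setP => g; rewrite !inE; apply/andP/eqP => [[gM]|->]; last first.
    split=> //; apply/rt_ends_quot/(tree_attachP tO sT gT (MD f fM)).
    exact/(tree_attach_grown tO sT gT (MD f fM)).
  move=> /rt_ends_quot/(tree_attachP tO sT gT (MD g gM)).
  by move=> /(tree_attach_grown tO sT gT (MD g gM)); apply: uniqf.
(* Some edge of the path to [e] can be attached to [T]; it belongs to [M], so it is [f] by
   uniqueness. *)
move=> e eM; have eG := subsetP sM e eM; have ge := rp_edge_grown eG.
have pTe : T \proper T :|: rp (ch e).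
  apply/properP; split; first exact: subsetUl.
  by exists e; rewrite ?MT // inE rp_mem ?orbT.
have [g gD gg] := grown_attach gT (gU gT ge) pTe.
have {gD} [gT' ge'] : g \notin T /\ g \in rp (ch e).
  by move: gD; rewrite !inE; case: (g \in T).
have eTM : e \in T :|: M by rewrite inE eM orbT.
have : g \in T :|: M := subsetP (rp_sub tO sTM gTM eTM) g ge'.
by rewrite inE (negPf gT') /= => gM; rewrite -(uniqf g gM gg).
Qed.

Lemma tree_run_inv S T s : grown G T -> S = with_root G T -> tree_run G S s ->
  (s = [::] /\ pz G T = pz G (edges G)) \/
  exists e s' M d, [/\ s = e :: s', tight G T M d,
    [/\ e \in M, grown G (e |: T) & forall g, g \in M -> e \in rp (ch g)] &
    tree_run G (with_root G (e |: T)) s'].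
Proof.
move=> gT -> run; have totE : total_prize (quot G T) = pz G (edges G) - pz G T.
  rewrite total_prize_quot ?vset_verts ?gE //; congr (_ - _).
  by rewrite /total_prize vertsY.
have ET : contract G (with_root G T) = quot G T by [].
inversion_clear run as [? tot0|? Tmm e s' tot0 mm attE run'].
  by left; split=> //; apply/esym/subr0_eq; rewrite -totE.
right; have lt : pz G T < pz G (edges G).
  rewrite lt_neqAle pzS ?gE // andbT; apply: contraNneq tot0 => TY.
  by rewrite ET totE TY subrr.
have [|M [d [ES tM]]] := min_max_tight admG gT _ mm.
  by exists (edges G); split=> //; apply: gE.
have [f [fM gf attf fA]] := tight_attach gT tM.
exists e, s', M, d; have ef : e = f.
  by apply/set1_inj; rewrite -attf -attE ES [with_root (quot G T) M]with_rootE.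
by rewrite sunion_with_root setUC in run'; split=> //; rewrite ef.
Qed.

(** [competitive] asks for an output as well, so the run must be shown to exist: every round finds a
    min-max subtree and adds a new edge. *)
Lemma tree_run_exists T : grown G T -> exists s, tree_run G (with_root G T) s.
Proof.
have [n] := ubnP #|edges G :\: T|; elim: n T => // n IHn T; rewrite ltnS => leTn gT.
have totE : total_prize (quot G T) = pz G (edges G) - pz G T.
  rewrite total_prize_quot ?vset_verts ?gE //; congr (_ - _).
  by rewrite /total_prize vertsY.
have [/eqP tot0|tot0] := boolP (total_prize (quot G T) == 0).
  by exists [::]; apply: tree_run_stop.
have lt : pz G T < pz G (edges G).
  rewrite lt_neqAle pzS ?gE // andbT; apply: contraNneq tot0 => TY.
  by rewrite totE TY subrr.
have [S mm] := min_max_exists admG gT.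
have [|M [d [ES tM]]] := min_max_tight admG gT _ mm.
  by exists (edges G); split=> //; apply: gE.
have [f [fM gf attf fA]] := tight_attach gT tM.
have [|s run] := IHn (f |: T) _ gf.
  apply: leq_trans leTn; apply: proper_card; apply/properP; split.
    by apply/setDS/subsetUr.
  exists f; last by rewrite !inE eqxx.
  rewrite inE (subsetP (gE gf)) ?setU11 // andbT; apply/negP => fT.
  by have /pred0P/(_ f) := tight_disjoint tM; rewrite /= fT fM.
exists (f :: s); apply: (tree_run_step (Tmm := S)) => //.
  by rewrite -attf ES [with_root (quot G T) M]with_rootE.
by rewrite sunion_with_root setUC.
Qed.

(* The state of a tree run that has started, but not completed, the min-max
   subtree of density d that extends its state to N. *)
Record saturating T N d : Prop := Saturating {
  sat_T : grown G T;
  sat_N : grown G N;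
  sat_sub : T \subset N;
  sat_gt0 : 0 < d;
  sat_out : forall X, grown G X ->
    pz G (X :|: N) - pz G N <= d * (ct G (X :|: N) - ct G N);
  sat_in : forall X, grown G X -> T \subset X -> X \proper N ->
    d * (ct G N - ct G X) < pz G N - pz G X }.

Lemma ct_proper T X : grown G X -> T \proper X -> ct G T < ct G X.
Proof.
move=> gX pTX; rewrite -subr_gt0 -ctD ?proper_sub //; apply: ct_gt0 => //.
  exact: subset_trans (subsetDl _ _) (gE gX).
by rewrite setD_eq0 proper_subn.
Qed.

(** The rest of [N] has density above [d], hence so has the best choice [M]. If [T :|: M] left [N],
    its part outside [N] would gain at most rate [d < d'], its part inside at most rate [d'], and by
    modularity [M] could not reach density [d']. *)
Lemma saturating_next T N d M d' : saturating T N d -> T != N -> tight G T M d' ->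
  d < d' /\ T :|: M \subset N.
Proof.
move=> sat TN tM; have [gT gN sTN d0 outN inN] := sat.
have pTN : T \proper N by rewrite properEneq TN.
have gTM := tight_grown tM; have dTM := tight_disjoint tM.
have ctM : ct G M = ct G (T :|: M) - ct G T.
  by rewrite -ctD ?subsetUl // setU_disjointK.
have dens := tight_density tM; rewrite ctM in dens.
have dd' : d < d'.
  have lt := lt_le_trans (inN T gT (subxx _) pTN) (tight_max tM gN sTN).
  by rewrite ltr_pM2r ?subr_gt0 ?ct_proper in lt.
split=> //; apply/negPn/negP => nsub.
have pNU : N \proper (T :|: M) :|: N.
  by rewrite properE subsetUr /= subUset negb_and nsub.
have le1 := outN _ gTM.
have lt1 : d * (ct G ((T :|: M) :|: N) - ct G N) < d' * (ct G ((T :|: M) :|: N) - ct G N).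
  by rewrite ltr_pM2r // subr_gt0 ct_proper //; apply: gU.
have gI : grown G ((T :|: M) :&: N) by apply: (tree_grownI tO) => //; apply: gE.
have sTI : T \subset (T :|: M) :&: N by rewrite subsetI subsetUl.
have le2 := tight_max tM gI sTI.
have := tree_pz_mod tO (gE gTM) (gE gN) gTM gN.
have cm := ct_mod G (T :|: M) N.
have cm' : d' * ct G ((T :|: M) :|: N) + d' * ct G ((T :|: M) :&: N) =
           d' * ct G (T :|: M) + d' * ct G N by rewrite -!mulrDr cm.
move: le1 lt1 le2 dens; rewrite !mulrBr; lra.
Qed.

(** Strictness in [sat_in] comes from minimality: a part that contains [f] but is not all of
    [T :|: M] gains less than rate [d] over [T], so the remainder gains more. *)
Lemma saturating_start T M d f : grown G T -> tight G T M d -> f \in M ->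
  grown G (f |: T) -> saturating (f |: T) (T :|: M) d.
Proof.
move=> gT tM fM gf; have gTM := tight_grown tM; have dTM := tight_disjoint tM.
have ctM : ct G M = ct G (T :|: M) - ct G T.
  by rewrite -ctD ?subsetUl // setU_disjointK.
have dens := tight_density tM; rewrite ctM in dens.
split=> //.
- by rewrite setUC setUS ?sub1set.
- exact: tight_gt0 tM.
- move=> X gX; have sT : T \subset X :|: (T :|: M).
    exact: subset_trans (subsetUl _ _) (subsetUr _ _).
  have := tight_max tM (gU gX gTM) sT; move: dens; rewrite !mulrBr; lra.
move=> X gX sfX pX; have pTX : T \proper X.
  apply/properP; split; first exact: subset_trans (subsetUr _ _) sfX.
  exists f; first by rewrite (subsetP sfX) ?setU11.
  by apply/negP => fT; have /pred0P/(_ f) := dTM; rewrite /= fT fM.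
have := tight_min tM gX pTX pX; move: dens; rewrite !mulrBr; lra.
Qed.

Lemma saturating_step T T' N d : saturating T N d -> grown G T' -> T \subset T' ->
  T' \subset N -> saturating T' N d.
Proof.
move=> [gT gN sTN d0 outN inN] gT' sTT' sT'N; split=> // X gX sT'X.
by apply: inN => //; apply: subset_trans sT'X.
Qed.

(* Whenever the run is about to add e, the collected prize pays at rate d for all
   edges added so far, including e, except those on the path from T to e. *)
Definition paid d T (s : seq E) : Prop :=
  forall s1 e s2, s = s1 ++ e :: s2 ->
  [/\ grown G (T :|: [set g in s1]), grown G (T :|: [set g in rcons s1 e]),
      e \notin T :|: [set g in s1] &
      d * (ct G (T :|: [set g in s1]) - ct G T + cost G e
           - ct G (rp (ch e) :\: T)) <= pz G (T :|: [set g in s1]) - pz G T].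

Lemma set_cons (e : E) s : [set g in e :: s] = e |: [set g in s].
Proof. by apply/setP => g; rewrite !inE. Qed.

Lemma set_cat (s t : seq E) : [set g in s ++ t] = [set g in s] :|: [set g in t].
Proof. by apply/setP => g; rewrite !inE mem_cat. Qed.

Lemma ctU1 (e : E) F : e \notin F -> ct G (e |: F) = cost G e + ct G F.
Proof. exact: big_setU1. Qed.

(** Since [f] lies on the path to every edge of [s], its cost appears once among the added edges and
    once in the path measured from [T], and cancels. When [f] itself is added, its cost is covered
    by its own path. *)
Lemma paid_cons d d' T f s : 0 < d -> d <= d' -> grown G T -> grown G (f |: T) ->
  f \notin T -> (forall e, e \in s -> f \in rp (ch e)) ->
  paid d' (f |: T) s -> paid d T (f :: s).
Proof.
move=> d0 dd' gT gf fT fs paid_s [|f' s1] e s2 /=.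
  case=> <- _; have eG : f \in edges G := subsetP (gE gf) _ (setU11 _ _).
  rewrite set_cons set_nil setU0 !subrr add0r setU0 [T :|: _]setUC; split=> //.
  rewrite pmulr_rle0 // subr_le0.
  rewrite [ct G _](bigD1 f) /=; last by rewrite inE fT rp_mem.
  rewrite lerDl; apply: sumr_ge0 => g /andP[]; rewrite inE => /andP[_ ge] _.
  have [_ cG _] := admG; apply/ltW/cG.
  exact: subsetP (gE (rp_edge_grown eG)) _ ge.
case=> <- Es; have [g1 g2 es1 pay] := paid_s _ _ _ Es.
have es : e \in s by rewrite Es mem_cat mem_head orbT.
have TE (t : seq E) : T :|: [set g in f :: t] = (f |: T) :|: [set g in t].
  by rewrite set_cons setUCA setUA.
rewrite -rcons_cons !TE; split=> //.
have eG : e \in edges G.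
  apply: (subsetP (gE g2)); rewrite inE; apply/orP; right.
  by rewrite inE mem_rcons mem_head.
have ctA : ct G (rp (ch e) :\: T) = cost G f + ct G (rp (ch e) :\: (f |: T)).
  rewrite -ctU1; last by rewrite !inE eqxx.
  congr (ct G _); apply/setP => g; rewrite !inE.
  by have [->|gf'] := eqVneq g f; rewrite //= fT fs.
move: pay; set S := (f |: T) :|: _ => pay.
have le1 : pz G (f |: T) >= pz G T by apply: pzS; rewrite ?subsetUr ?gE.
move: pay; rewrite (ctU1 fT) ctA.
set Q := (X in d' * X <= _) => pay.
rewrite (_ : ct G S - _ + _ - _ = Q); last by rewrite /Q; lra.
(* Lowering the rate from [d'] to [d] preserves the bound only for nonnegative [Q]; for negative [Q]
   the left side is negative, while the collected prize has not decreased. *)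
have [Q0|Q0] := leP 0 Q.
  apply: (@le_trans _ _ (d' * Q)); first exact: ler_wpM2r.
  by apply: le_trans pay _; rewrite lerB.
apply: (@le_trans _ _ 0); first by rewrite pmulr_rle0 // ltW.
rewrite subr_ge0; apply: pzS; rewrite ?gE //.
by apply: subset_trans (subsetUl _ _); apply: subsetUr.
Qed.

(** The next min-max subtree [M] is denser and stays inside [N]. The induction is used twice: from
    [f |: T] to [T :|: M] at rate [d'], then from [T :|: M] to [N] at rate [d]. Both intervals are
    shorter, as neither has to add [f]. *)
Lemma tree_run_saturate T N d s : saturating T N d -> tree_run G (with_root G T) s ->
  exists s1 s2, [/\ s = s1 ++ s2, tree_run G (with_root G N) s2,
    N = T :|: [set e in s1] & paid d T s1].
Proof.
have [n] := ubnP #|N :\: T|; elim: n T N d s => // n IHn T N d s; rewrite ltnS => leTn.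
move=> sat run; have [<-|TN] := eqVneq T N.
  by exists [::], s; split=> //; [rewrite set_nil setU0|case].
have [gT gN sTN d0 _ inN] := sat.
have pTN : T \proper N by rewrite properEneq TN.
have [[_ pzTY]|[f [s' [M [d' [-> tM [fM gf fA] run']]]]]] := tree_run_inv gT erefl run.
  (* The run cannot stop before [N]: by [sat_in] the rest of [N] still bears prize. *)
  have := inN T gT (subxx _) pTN; rewrite pzTY => lt.
  have pos : 0 < d * (ct G N - ct G T) by rewrite pmulr_rgt0 // subr_gt0 ct_proper.
  by have := lt_trans pos lt; rewrite subr_gt0 ltNge pzS ?gE.
have [dd' sTMN] := saturating_next sat TN tM.
have sat1 := saturating_start gT tM fM gf.
have fT : f \notin T.
  by apply/negP => fT; have /pred0P/(_ f) := tight_disjoint tM; rewrite /= fT fM.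
have [|s1 [s2 [Es' run2 TM1 paid1]]] := IHn _ _ _ _ _ sat1 run'.
  apply: leq_trans leTn; apply: proper_card; apply/properP; split.
    apply: subset_trans (setSD _ sTMN) _; exact/setDS/subsetUr.
  exists f; last by rewrite !inE eqxx.
  by rewrite inE fT (subsetP sTMN) // inE fM orbT.
have sat2 := saturating_step sat (tight_grown tM) (subsetUl _ _) sTMN.
have [|s3 [s4 [Es2 run4 N3 paid3]]] := IHn _ _ _ _ _ sat2 run2.
  apply: leq_trans leTn; apply: proper_card; apply/properP; split.
    exact/setDS/subsetUl.
  exists f; last by rewrite !inE fM orbT.
  by rewrite inE fT (subsetP sTMN) // inE fM orbT.
exists (f :: s1 ++ s3), s4; split=> //.
- by rewrite Es' Es2 catA.
- by rewrite N3 TM1 set_cons set_cat !setUA [T :|: _]setUC.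
have fs1 e : e \in s1 -> f \in rp (ch e).
  move=> es1; apply: fA; have : e \in T :|: M by rewrite TM1 !inE es1 orbT.
  case/setUP => // eT; have [t1 [t2 Et]] : exists t1 t2, s1 = t1 ++ e :: t2.
    by case/splitPr: es1 => t1 t2; exists t1, t2.
  by have [_ _] := paid1 _ _ _ Et; rewrite !inE eT orbT.
have paid_f := paid_cons d0 (ltW dd') gT gf fT fs1 paid1.
move=> t1 e t2 Est; have := cat_cons_split (esym (Est : (f :: s1) ++ s3 = _)).
case=> [[t3 [E1 _]]|[t3 [-> E3]]]; first exact: paid_f E1.
have TE t : T :|: [set g in (f :: s1) ++ t] = (T :|: M) :|: [set g in t].
  by rewrite set_cat set_cons TM1 !setUA [T :|: _]setUC.
have [g1 g2 et3 pay] := paid3 _ _ _ E3.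
rewrite rcons_cat !TE; split=> //.
(* An edge added after [M] is complete: [M] has paid for all its edges at rate [d' > d], and
   starting at [T] instead of [T :|: M] can only enlarge the exempt path. *)
have leA : ct G (rp (ch e) :\: (T :|: M)) <= ct G (rp (ch e) :\: T).
  apply: ctS => //; first exact/setDS/subsetUl.
  apply: subset_trans (subsetDl _ _) (gE (rp_edge_grown _)).
  by apply: (subsetP (gE g2)); rewrite inE [e \in [set _ in _]]inE mem_rcons mem_head orbT.
have ctM : ct G M = ct G (T :|: M) - ct G T.
  by rewrite -ctD ?subsetUl // setU_disjointK ?(tight_disjoint tM).
have dens := tight_density tM; rewrite ctM in dens.
have leM : d * (ct G (T :|: M) - ct G T) <= d' * (ct G (T :|: M) - ct G T).
  apply: ler_wpM2r (ltW dd'); rewrite subr_ge0 ctS ?subsetUl //.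
  exact/gE/tight_grown/tM.
have leA' : d * ct G (rp (ch e) :\: (T :|: M)) <= d * ct G (rp (ch e) :\: T).
  by rewrite ler_pM2l.
move: pay dens leM leA'; rewrite !(mulrBr, mulrDr); lra.
Qed.

(** The first min-max subtree must be the whole tree: its density is at least [d], whereas proper
    subtrees stay below [d]. Saturating it therefore accounts for the entire run, since no edge
    remains afterwards. *)
Lemma tree_density_greedy_paid d s : tight G set0 (edges G) d ->
  tree_density_greedy G s -> [set e in s] = edges G /\ paid d set0 s.
Proof.
move=> tY; rewrite /tree_density_greedy root_onlyE => run.
have g0 : grown G set0 by apply: grown0.
have d0 := tight_gt0 tY; have densY := tight_density tY; rewrite set0U in densY.
have ctY : 0 < ct G (edges G) by apply: ct_gt0 => //; apply: tight_neq0 tY.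
have [[_ pz0]|[f [s' [M [d' [-> tM [fM gf fA] run']]]]]] := tree_run_inv g0 erefl run.
  by have := mulr_gt0 d0 ctY; rewrite -densY -pz0 subrr ltxx.
have gM := tight_grown tM; rewrite set0U in gM.
have ct0 : ct G set0 = 0 by apply: big_set0.
have le_dd' : d <= d'.
  by have := tight_max tM gY (sub0set _); rewrite densY ct0 subr0 ler_pM2r.
have MY : M = edges G.
  apply/eqP/negPn/negP => neMY; have pM : M \proper set0 :|: edges G.
    by rewrite set0U properEneq neMY gE.
  have pM0 : set0 \proper M by rewrite proper0; apply: tight_neq0 tM.
  have := tight_min tY gM pM0 pM; rewrite -[X in pz G X](set0U M) (tight_density tM).
  by rewrite ct0 subr0 ltNge ler_wpM2r // ct_ge0 ?gE.
rewrite MY in fM fA tM.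
have satY := saturating_start g0 tY fM gf; rewrite set0U in satY.
have [s1 [s2 [Es' run2 Y1 paid1]]] := tree_run_saturate satY run'.
have s20 : s2 = [::].
  have [[]//|[e [_ [N [d2 [_ tN [eN _ _] _]]]]]] := tree_run_inv gY erefl run2.
  have eY : e \in edges G by apply: (subsetP (gE (tight_grown tN))); rewrite inE eN orbT.
  by have /pred0P/(_ e) := tight_disjoint tN; rewrite /= eY eN.
rewrite Es' s20 cats0; split; first by rewrite set_cons [RHS]Y1 setU0.
apply: (paid_cons d0 (lexx d)) => //; first by rewrite inE.
by move=> e es1; apply: fA; rewrite Y1 !inE es1 orbT.
Qed.

End TreeRun.

(** * The density-greedy algorithm on graphs *)

Section GraphRun.
Variables (R : realType) (V E : finType).
Implicit Types (F T X Y Z M N O : {set E}).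
Variable G : rooted_mgraph R V E.
Hypothesis admG : admissible G.
Hypothesis reachG :
  forall v, v \in verts G -> 0 < prize G v -> reachable G (rt G) v.

Let wfG : wf_mgraph G. Proof. by case: admG. Qed.

Let gE T : grown G T -> T \subset edges G. Proof. exact: grown_edges. Qed.

(** * The min-max subtree as input of the tree algorithm *)

Section QuotientTree.
Variables (T M : {set E}) (d : R).
Hypotheses (gT : grown G T) (tM : tight G T M d).

Let H := as_graph (quot G T) (with_root (quot G T) M).

Lemma edges_min_max : edges H = M. Proof. by rewrite /H with_rootE. Qed.

Lemma verts_min_max : verts H = vset H (edges H).
Proof. by rewrite edges_min_max /H with_rootE. Qed.

Let gM : grown (quot G T) M.
Proof. by apply: grown_quot => //; [apply: tight_disjoint tM|apply: tight_grown tM]. Qed.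

Lemma grown_min_maxP X : grown H X <-> X \subset M /\ grown (quot G T) X.
Proof.
split=> [gX|[sXM gX]].
  split; first by rewrite -edges_min_max grown_edges.
  elim: gX => [|{}X e x y _ gX eH ends_e xX yX]; first exact: grown0.
  apply: (grownU1 gX _ ends_e xX yX).
  by apply: subsetP (grown_edges gM) _ _; rewrite -edges_min_max.
elim: gX sXM => [|{}X e x y _ IHX eH ends_e xX yX]; first by move=> _; apply: grown0.
rewrite subUset sub1set => /andP[eM /IHX gX].
by apply: (grownU1 gX _ ends_e xX yX); rewrite edges_min_max.
Qed.

Let grownHG X : grown H X -> grown G (T :|: X) /\ [disjoint T & X].
Proof. by case/grown_min_maxP => _; apply: grown_quot_sub. Qed.

Lemma admissible_min_max : admissible H.
Proof.
have [[rQ endsQ pairsQ] cQ pQ] := admissible_quot T admG.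
have sM := grown_edges gM.
split; first split.
- by rewrite verts_min_max rt_vset.
- by move=> e eH; rewrite verts_min_max; apply: ends_vset.
- by move=> e; rewrite edges_min_max => /(subsetP sM)/pairsQ.
- by move=> e; rewrite edges_min_max => /(subsetP sM)/cQ.
move=> v; rewrite verts_min_max edges_min_max => vM; apply: pQ.
by apply: (subsetP (vset_verts (wf_quot T wfG) sM)).
Qed.

Lemma grown_min_max : grown H (edges H).
Proof. by rewrite edges_min_max; apply/grown_min_maxP. Qed.

Lemma pz_min_max X : pz H X = pz G (T :|: X) - pz G T.
Proof. by rewrite -pz_quot. Qed.

Lemma tight_min_max : tight H set0 (edges H) d.
Proof.
have dTM := tight_disjoint tM.
have ctT X : [disjoint T & X] -> ct G X = ct G (T :|: X) - ct G T.
  by move=> dTX; rewrite ctU // addrAC subrr add0r.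
have ct0 : ct H set0 = 0 by apply: big_set0.
split.
- by rewrite set0U; apply: grown_min_max.
- by rewrite disjoints_subset sub0set.
- by rewrite edges_min_max; apply: tight_neq0 tM.
- exact: tight_gt0 tM.
- by rewrite !pz_min_max set0U setU0 subrr subr0 edges_min_max (tight_density tM).
- move=> X /grownHG[gX dX] _; rewrite !pz_min_max setU0 subrr !subr0 ct0 subr0.
  rewrite [ct H X](_ : _ = ct G X) // (ctT X dX).
  exact: (tight_max tM gX (subsetUl _ _)).
move=> X /grownHG[gX dX]; rewrite set0U edges_min_max => X0 XM.
rewrite !pz_min_max setU0 subrr !subr0 ct0 subr0 [ct H X](_ : _ = ct G X) // (ctT X dX).
apply: (tight_min tM gX).
  rewrite properEneq subsetUl andbT; apply: contraTneq X0 => TX.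
  by rewrite -(setU_disjointK dX) -TX setDv properxx.
rewrite properEneq setUS ?proper_sub // andbT; apply: contraTneq XM => XM.
by rewrite -(setU_disjointK dX) XM (setU_disjointK dTM) properxx.
Qed.

Lemma min_max_run_exists : exists s, tree_density_greedy H s.
Proof.
have [pa [ch [rp tO]]] := tree_orderE grown_min_max.
rewrite /tree_density_greedy root_onlyE.
exact: (tree_run_exists admissible_min_max grown_min_max verts_min_max tO (grown0 _)).
Qed.

(** The edges of [rp v] are traversed by a simple path of [G] from the root, each once. *)
Lemma rp_cost Y pa ch rp v (gamma : R) : tree_order G Y pa ch rp ->
  (forall s, simple_path G (rt G) s -> path_cost G s <= gamma) ->
  v \in vset G Y -> ct G (rp v) <= gamma.
Proof.
move=> tO maxg vY; have [s [simps _ _ <-]] := to_path tO vY.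
apply: le_trans (maxg s simps); rewrite /path_cost /ct.
rewrite (eq_bigl (mem (unzip1 s))); last by move=> e; rewrite inE.
by rewrite -big_uniq ?(simple_path_uniq_edges simps) //= big_map.
Qed.

Lemma min_max_run_paid (gamma : R) s :
  (forall p, simple_path G (rt G) p -> path_cost G p <= gamma) ->
  tree_density_greedy H s ->
  [set e in s] = M /\ forall s1 e s2, s = s1 ++ e :: s2 ->
    [/\ grown G (T :|: [set g in s1]), grown G (T :|: [set g in rcons s1 e]),
        e \notin T :|: [set g in s1] &
        d * (ct G (T :|: [set g in s1]) - ct G T + cost G e - gamma) <=
        pz G (T :|: [set g in s1]) - pz G T].
Proof.
move=> maxg run; have [pa [ch [rp tO]]] := tree_orderE grown_min_max.
have [] := tree_density_greedy_paid admissible_min_max grown_min_max verts_min_max tO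
  tight_min_max run.
rewrite edges_min_max => sM paid_s; split=> // s1 e s2 Es.
have [] := paid_s s1 e s2 Es; rewrite !set0U setD0 => /grownHG[g1 d1] /grownHG[g2 d2] e1.
have eM : e \in M by rewrite -sM inE Es mem_cat mem_head orbT.
have dTM := tight_disjoint tM.
have eT : e \notin T.
  by apply/negP => eT; have /pred0P/(_ e) := dTM; rewrite /= eT eM.
rewrite !pz_min_max setU0 subrr subr0 => pay; split=> //; first by rewrite inE negb_or eT.
apply: le_trans pay; apply: ler_wpM2l; first exact/ltW/(tight_gt0 tM).
have -> : ct H [set g in s1] - ct H set0 = ct G (T :|: [set g in s1]) - ct G T.
  by rewrite [ct H set0]big_set0 subr0 ctU // addrAC subrr add0r.
rewrite lerD2l lerN2.
(* A second order, on the tree [T :|: M] of [G]: [rp] describes paths of the contracted tree, on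
   which [gamma] gives no direct bound. The edges outside [T] of the path [rp'] through [e] form a
   rooted subtree of [H] containing [e], so they include the path [rp] to [e]. *)
have gTM := tight_grown tM; have [pa' [ch' [rp' tO']]] := tree_orderE gTM.
have eTM : e \in T :|: M by rewrite inE eM orbT.
have vTM : ch' e \in vset G (T :|: M).
  by apply: (subsetP (ends_vset G eTM)); rewrite (to_ends tO' eTM) set22.
apply: le_trans (rp_cost tO' maxg vTM).
have [gA sA _] := to_rp_grown tO' vTM.
have eA : e \in rp' (ch' e) by rewrite (to_rp tO' eTM) setU11.
have gTA : grown G (T :|: rp' (ch' e)) by apply: (tree_grownU tO') => //; apply: subsetUl.
have sAT : (T :|: rp' (ch' e)) :\: T \subset rp' (ch' e) by rewrite subDset.
have gHA : grown H ((T :|: rp' (ch' e)) :\: T).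
  apply/grown_min_maxP; split; last by apply: grown_quotD => //; apply: subsetUl.
  by rewrite subDset subUset subsetUl.
have /= sub := rp_sub tO (grown_edges gHA) gHA (e := e).
rewrite [ct H _](_ : _ = ct G (rp (ch e))) //; apply: ctS => //; last exact: gE.
by apply: subset_trans sAT; apply: sub; rewrite !inE eT eA orbT.
Qed.

End QuotientTree.

(** * Runs on the whole graph *)

Lemma prize_outside T : T \subset edges G -> pz G T != total_prize G ->
  exists v, [/\ v \in verts G, v \notin vset G T & 0 < prize G v].
Proof.
move=> sT ne; have [_ _ pG] := admG.
have [/existsP[v /and3P[]]|] :=
    boolP [exists v, [&& v \in verts G, v \notin vset G T & 0 < prize G v]].
  by exists v.
move=> /existsPn none; case/eqP: ne; rewrite /total_prize.
rewrite (big_setID (vset G T)) /= (setIidPr (vset_verts wfG sT)).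
rewrite [X in _ = _ + X]big1 ?addr0 // => v; rewrite inE => /andP[vT vG].
have := none v; rewrite vG vT /= -leNgt => le0; apply/eqP.
by rewrite eq_le le0 pG.
Qed.

Lemma pz_lt T X v : T \subset X -> X \subset edges G -> v \in vset G X ->
  v \notin vset G T -> 0 < prize G v -> pz G T < pz G X.
Proof.
move=> sTX sX vX vT pv; have [_ _ pG] := admG.
rewrite /pz [ltRHS](big_setID (vset G T)) /= (setIidPr (vsetS G sTX)) ltrDl.
rewrite (bigD1 v) ?inE ?vT //= ltr_wpDr //; apply: sumr_ge0 => w.
by rewrite inE => /andP[/andP[_ wX] _]; apply/pG/(subsetP (vset_verts wfG sX)).
Qed.

(** Here reachability enters: a walk from the root to an uncollected prize extends [T] to a rooted
    subtree that covers it. *)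
Lemma graph_progress T : grown G T -> total_prize (quot G T) != 0 ->
  exists X, [/\ grown G X, T \subset X & pz G T < pz G X].
Proof.
move=> gT; rewrite total_prize_quot ?vset_verts ?gE // subr_eq0 eq_sym => ne.
have [v [vG vT pv]] := prize_outside (gE gT) ne.
have [s ws es] := reachG vG pv.
have [X [gX sTX]] := walk_grown gT (rt_vset G T) ws; rewrite es => vX.
by exists X; split=> //; apply: (pz_lt sTX (gE gX) vX vT pv).
Qed.

Lemma graph_run_inv S T pi : grown G T -> S = with_root G T -> graph_run G S pi ->
  (pi = [::] /\ pz G T = total_prize G) \/
  exists M d sigma pi', [/\ pi = sigma ++ pi', tight G T M d,
    tree_density_greedy (as_graph (quot G T) (with_root (quot G T) M)) sigma &
    graph_run G (with_root G (T :|: M)) pi'].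
Proof.
move=> gT -> run; inversion_clear run as [? tot0|? S' sigma pi' tot0 mm tree_run run'].
  left; split=> //; apply/esym/subr0_eq; rewrite -tot0.
  by rewrite -total_prize_quot ?vset_verts ?gE.
have [M [d [ES tM]]] := min_max_tight admG gT (graph_progress gT tot0) mm.
right; exists M, d, sigma, pi'; split=> //; first by rewrite -ES.
by move: run'; rewrite /extension sunion_with_root ES [with_root (quot G T) M]with_rootE.
Qed.

Lemma graph_run_exists T : grown G T -> exists pi, graph_run G (with_root G T) pi.
Proof.
have [n] := ubnP #|edges G :\: T|; elim: n T => // n IHn T; rewrite ltnS => leTn gT.
have [/eqP tot0|tot0] := boolP (total_prize (quot G T) == 0).
  by exists [::]; apply: graph_run_stop.
have [S mm] := min_max_exists admG gT.
have [M [d [ES tM]]] := min_max_tight admG gT (graph_progress gT tot0) mm.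
have [sigma tree_run] := min_max_run_exists gT tM.
have gTM := tight_grown tM.
have [|pi run] := IHn (T :|: M) _ gTM.
  apply: leq_trans leTn; apply: proper_card; apply/properP; split.
    by apply/setDS/subsetUl.
  have /set0Pn[e eM] := tight_neq0 tM.
  have eT : e \notin T.
    by apply/negP => eT; have /pred0P/(_ e) := tight_disjoint tM; rewrite /= eT eM.
  exists e; last by rewrite !inE eM orbT.
  by rewrite inE eT (subsetP (gE gTM)) // inE eM orbT.
exists (sigma ++ pi); apply: (graph_run_step (Tmm := S)) => //; first by rewrite ES.
by rewrite /extension sunion_with_root ES [with_root (quot G T) M]with_rootE.
Qed.

(* The densities of the min-max subtrees do not increase, so T pays for its edges
   at the density of the next one. *)
Definition paid_off T : Prop := forall M d, tight G T M d -> d * ct G T <= pz G T.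

Lemma paid_off0 : paid_off set0.
Proof.
move=> M d _; rewrite [ct _ _]big_set0 mulr0; apply: pz_ge0 => //; exact: sub0set.
Qed.

Lemma paid_offU T M d : grown G T -> tight G T M d -> paid_off T -> paid_off (T :|: M).
Proof.
move=> gT tM pT M' d' tM'.
have gTM := tight_grown tM; have gTM' := tight_grown tM'.
have sTM' : T \subset (T :|: M) :|: M' by rewrite -setUA subsetUl.
have le := tight_max tM gTM' sTM'.
have ctM := ctU G (tight_disjoint tM).
have ctM' := ctU G (tight_disjoint tM').
have sM' : M' \subset edges G by apply: subset_trans (gE gTM'); apply: subsetUr.
have ctM'0 : 0 < ct G M' by apply: ct_gt0 => //; apply: tight_neq0 tM'.
have dens := tight_density tM; have dens' := tight_density tM'.
(* If [M'] were denser than [M], then [M] and [M'] together would exceed the maximum density over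
   [T]. *)
have dd' : d' <= d.
  rewrite -(ler_pM2r ctM'0); move: le dens dens'; rewrite ctM' ctM !(mulrBr, mulrDr).
  lra.
apply: (@le_trans _ _ (d * ct G (T :|: M))).
  by apply: ler_wpM2r => //; apply: ct_ge0 => //; apply: gE.
have := pT _ _ tM; move: dens; rewrite ctM mulrDr; lra.
Qed.

Lemma graph_run_competitive (gamma : R) S T pi :
  (forall p, simple_path G (rt G) p -> path_cost G p <= gamma) ->
  grown G T -> S = with_root G T -> paid_off T -> graph_run G S pi ->
  [/\ grown G (T :|: [set e in pi]), pz G (T :|: [set e in pi]) = total_prize G &
  forall s1 e s2, pi = s1 ++ e :: s2 ->
    let U := T :|: [set g in s1] in
    [/\ grown G U, grown G (T :|: [set g in rcons s1 e]), e \notin U &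
        forall O, grown G O -> ct G O <= ct G U + cost G e - gamma ->
          pz G O <= 2 * pz G U]].
Proof.
move=> maxg gT ES pT run.
have [n] := ubnP (size pi + #|edges G :\: T|)%N.
elim: n S T pi gT ES pT run => // n IHn S T pi gT ES pT run; rewrite ltnS => len.
have [[Epi totT]|[M [d [sigma [pi' [Epi tM tree_run run']]]]]] := graph_run_inv gT ES run.
  by rewrite Epi set_nil setU0; split=> // -[].
have gTM := tight_grown tM.
have [EM payM] := min_max_run_paid gT tM maxg tree_run.
have [|g' tot' pay'] := IHn _ _ _ gTM erefl (paid_offU gT tM pT) run'.
  apply: leq_trans len; rewrite Epi size_cat -addnA -add1n; apply: leq_add.
    by case: (sigma) EM (tight_neq0 tM) => [<-|//]; rewrite set_nil eqxx.
  by rewrite leq_add2l; apply/subset_leq_card/setDS/subsetUl.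
have TE s : T :|: [set g in sigma ++ s] = (T :|: M) :|: [set g in s].
  by rewrite set_cat EM setUA.
split; [by rewrite Epi TE|by rewrite Epi TE|].
move=> s1 e s2 Es12; rewrite Epi in Es12.
have [[t' [Es _]]|[t' [-> Es]]] := cat_cons_split (esym Es12); last first.
  by have := pay' _ _ _ Es; rewrite rcons_cat !TE.
have [gU gUe eU pay] := payM _ _ _ Es; split=> // O gO leO.
(* [X] contains [T], covers the vertices of [O] and costs at most [ct G O] more than [T], so
   maximality of [d] over [T] bounds the prize of [O]. *)
have [X [gX sTX sXTO vX]] := grown_join gT gO.
have leX := tight_max tM gX sTX.
have leOX : pz G O <= pz G X by apply: pzS_vset; rewrite ?gE // vX subsetUr.
have leXO : ct G X - ct G T <= ct G O.
  by rewrite -ctD //; apply: ctS; rewrite ?gE // subDset.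
have leTU : pz G T <= pz G (T :|: [set g in s1]) by apply: pzS; rewrite ?subsetUl ?gE.
have d0 := tight_gt0 tM.
have le1 : d * (ct G X - ct G T) <= d * ct G O by rewrite ler_pM2l.
have le2 : d * ct G O <= d * (ct G (T :|: [set g in s1]) + cost G e - gamma).
  by rewrite ler_pM2l.
(* With U the collected part, [pay] and [paid_off] together give d (c(U) + c(e) - gamma) <= p(U).
   Hence p(O) <= p(T) + d c(O) <= p(T) + p(U), and p(T) <= p(U) gives the factor 2. *)
have := pT _ _ tM; move: pay leX le1 le2; rewrite !(mulrBr, mulrDr); lra.
Qed.

(** [alg] selects indices one by one; as costs are positive, the prefix sums are monotone and the
    selection is a prefix. It ends just before the first edge [e] that exceeds the budget. *)
Lemma alg_cases pi (B : R) : {subset pi <= edges G} ->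
  alg G pi B = with_root G [set e in pi] \/
  exists s1 e s2, [/\ pi = s1 ++ e :: s2, alg G pi B = with_root G [set g in s1] &
    B < \sum_(g <- rcons s1 e) cost G g].
Proof.
move=> piG; have [_ cG _] := admG.
pose P i := \sum_(g <- take i.+1 pi) cost G g <= B.
have Pmono i j : (i <= j)%N -> P j -> P i.
  move=> leij; apply: le_trans.
  rewrite -(cat_take_drop i.+1 (take j.+1 pi)) big_cat /= take_takel // lerDl.
  rewrite big_seq; apply: sumr_ge0 => g /mem_drop/mem_take/piG/cG; exact: ltW.
have [all|] := boolP [forall i : 'I_(size pi), P i].
  left; congr with_root; apply/setP => g; rewrite inE; apply/imsetP/idP.
    by case=> i _ ->; apply: mem_tnth.
  move=> gpi; have ig : (index g pi < size pi)%N by rewrite index_mem.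
  exists (Ordinal ig); first by rewrite inE; apply: (forallP all (Ordinal ig)).
  by rewrite (tnth_nth g) /= nth_index.
rewrite negb_forall => /existsP[i0 Pi0].
have exP : exists i, (i < size pi)%N && ~~ P i by exists i0; rewrite ltn_ord.
case: (ex_minnP exP) => i /andP[ipi nPi] minP; right.
case Epi: (drop i pi) => [|e s2].
  by have := congr1 size Epi; rewrite size_drop /= => /eqP; rewrite subn_eq0 leqNgt ipi.
have Etake : pi = take i pi ++ e :: s2 by rewrite -Epi cat_take_drop.
have Erc : take i.+1 pi = rcons (take i pi) e.
  rewrite {1}Etake take_cat size_takel ?(ltnW ipi) // ltnNge leqnSn /= subSnn /=.
  by rewrite take0 cats1.
exists (take i pi), e, s2; split=> //; last by rewrite -Erc ltNge.
congr with_root; apply/setP => g; rewrite inE; apply/imsetP/idP => [[j]|gi].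
  rewrite inE => Pj ->; rewrite (tnth_nth e) /=.
  have ji : (j < i)%N by rewrite ltnNge; apply: contra nPi => /Pmono; apply.
  by rewrite -(nth_take e ji) mem_nth // size_takel // ltnW.
have gi' : (index g (take i pi) < i)%N.
  by move: gi; rewrite -index_mem size_takel // ltnW.
have gs : (index g (take i pi) < size pi)%N by apply: ltn_trans ipi.
exists (Ordinal gs).
  rewrite inE; apply/negPn/negP => nP; have := minP (index g (take i pi)).
  by rewrite gs nP => /(_ isT); rewrite leqNgt gi'.
by rewrite (tnth_nth e) /= -(nth_take e gi') nth_index.
Qed.

Lemma density_greedy_exists : exists pi, density_greedy G pi.
Proof. by rewrite /density_greedy root_onlyE; apply/graph_run_exists/grown0. Qed.

Lemma density_greedy_competitive (gamma : R) pi :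
  (forall p, simple_path G (rt G) p -> path_cost G p <= gamma) ->
  density_greedy G pi ->
  incremental_solution G pi /\
  forall B : R, 0 <= B -> forall O : sgraph V E, optimal G B O ->
    sprize G O <= 2 * sprize G (alg G pi (B + gamma)).
Proof.
move=> maxg run; have [gpi totpi main] := graph_run_competitive maxg
  (grown0 G) (root_onlyE G) paid_off0 run.
rewrite set0U in gpi totpi.
(* Every edge is new at the moment it is appended. *)
have upi : uniq pi.
  have: forall s1 e s2, pi = s1 ++ e :: s2 -> e \notin s1.
    by move=> s1 e s2 /main[_ _]; rewrite !inE.
  elim/last_ind: (pi) => // s e IHs split_s.
  rewrite rcons_uniq (split_s s e [::]) ?cats1 //=; apply: IHs => s1 f s2 Es.
  by apply: (split_s s1 f (rcons s2 e)); rewrite Es rcons_cat.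
split; first split=> //.
- move=> i _; apply: grown_rooted_subtree => //.
  case/lastP Ei: (take i pi) => [|s1 e]; first by rewrite set_nil; apply: grown0.
  have [|_] := main s1 e (drop i pi); last by rewrite set0U.
  by rewrite -{1}(cat_take_drop i pi) Ei cat_rcons.
- move=> v vG pv; rewrite with_rootE /=; apply/negPn/negP => vpi.
  suff: pz G [set e in pi] < total_prize G by rewrite totpi ltxx.
  have [_ _ pG] := admG; rewrite /total_prize (big_setID (vset G [set e in pi])) /=.
  rewrite (setIidPr (vset_verts wfG (gE gpi))) ltrDl.
  rewrite (bigD1 v) ?inE ?vpi //= ltr_wpDr //; apply: sumr_ge0 => w.
  by rewrite inE => /andP[/andP[_ /pG]].
move=> B B0 O [rO cO _]; have [EO gO] := rooted_subtree_grown wfG rO.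
move: cO; rewrite EO scostE sprizeE => cO.
have [|->|[s1 [e [s2 [Epi -> lt]]]]] := alg_cases (B + gamma) (pi := pi).
- by move=> e epi; apply: (subsetP (gE gpi)); rewrite inE.
- rewrite sprizeE totpi; have := pz_le_total admG (gE gO).
  have := pz_ge0 admG (gE gpi); rewrite totpi; lra.
(* Exceeding [B + gamma] by adding [e] means that [B], and so the cost of [O], is below the cost of
   [s1] and [e] minus [gamma]. *)
have [gU gUe eU comp] := main s1 e s2 Epi.
rewrite sprizeE; rewrite set0U in comp eU *; apply: comp => //.
have E1 : \sum_(g <- rcons s1 e) cost G g = ct G [set g in s1] + cost G e.
  rewrite -cats1 big_cat /= big_seq1; congr (_ + _).
  rewrite /ct [RHS](eq_bigl (mem s1)); last by move=> g; rewrite inE.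
  have us1 : uniq s1 by move: upi; rewrite Epi cat_uniq => /and3P[].
  by rewrite -big_uniq.
rewrite E1 in lt; lra.
Qed.

End GraphRun.

(** * The instance for the eccentricity *)

Section Counterexample.
Variable R : realType.

Let o0 : 'I_5 := @Ordinal 5 0 isT.
Let o1 : 'I_5 := @Ordinal 5 1 isT.
Let o2 : 'I_5 := @Ordinal 5 2 isT.
Let o3 : 'I_5 := @Ordinal 5 3 isT.
Let o4 : 'I_5 := @Ordinal 5 4 isT.

Definition cex_ends (e : 'I_5) : {set 'I_5} :=
  match val e with
  | 0 => [set o0; o1] | 1 => [set o1; o2] | 2 => [set o1; o3]
  | 3 => [set o0; o3] | _ => [set o0; o4]
  end.

(** The edges [o0], [o1], [o2] cost 27 and bear prize 27, so they have density 1, and all other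
    rooted subtrees stay below. Once [o0] is taken, [o2] alone has density 19/8, against 8/4 for
    [o1] and 27/12 for both. The costs 15 + 8 = 23 exceed 20 + 2, the eccentricity plus the
    budget. *)
Definition cex_cost (e : 'I_5) : R :=
  match val e with 0 => 15 | 1 => 4 | 2 => 8 | 3 => 20 | _ => 2 end.

Definition cex_prize (v : 'I_5) : R :=
  match val v with 0 => 0 | 1 => 0 | 2 => 8 | 3 => 19 | _ => 1 end.

Definition cex_dist (v : 'I_5) : R :=
  match val v with 0 => 0 | 1 => 15 | 2 => 19 | 3 => 20 | _ => 2 end.

(* The two-edge path 0, 1, 3 costs 23 and bears no prize before its end, which
   is at distance 20; the leaf 2 makes it part of the densest subtree, and the
   leaf 4 makes the optimum positive already for the budget 2. *)
Definition cex : rooted_mgraph R 'I_5 'I_5 :=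
  RootedMGraph setT setT cex_ends o0 cex_cost cex_prize.

Let ord5P (P : 'I_5 -> Prop) : P o0 -> P o1 -> P o2 -> P o3 -> P o4 -> forall i, P i.
Proof.
move=> P0 P1 P2 P3 P4 [[|[|[|[|[|//]]]]] lti].
- by rewrite (_ : Ordinal _ = o0) //; apply: val_inj.
- by rewrite (_ : Ordinal _ = o1) //; apply: val_inj.
- by rewrite (_ : Ordinal _ = o2) //; apply: val_inj.
- by rewrite (_ : Ordinal _ = o3) //; apply: val_inj.
by rewrite (_ : Ordinal _ = o4) //; apply: val_inj.
Qed.

Let big5 (T : Type) (idx : T) (op : Monoid.law idx) (F : 'I_5 -> T) :
  \big[op/idx]_i F i = op (F o0) (op (F o1) (op (F o2) (op (F o3) (F o4)))).
Proof.
rewrite !big_ord_recl big_ord0 Monoid.mulm1.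
by congr (op (F _) (op (F _) (op (F _) (op (F _) (F _))))); apply: val_inj.
Qed.

Lemma cex_mem_vset (F : {set 'I_5}) :
  [/\ (o1 \in vset cex F) = [|| o0 \in F, o1 \in F | o2 \in F],
      (o2 \in vset cex F) = (o1 \in F),
      (o3 \in vset cex F) = (o2 \in F) || (o3 \in F) &
      (o4 \in vset cex F) = (o4 \in F)].
Proof.
rewrite vsetE big_mkcond big5 /=.
by split; rewrite !inE; case: (o0 \in F); case: (o1 \in F); case: (o2 \in F);
  case: (o3 \in F); case: (o4 \in F); rewrite !inE.
Qed.

Lemma cex_ct (F : {set 'I_5}) : ct cex F =
  (if o0 \in F then 15 else 0) + ((if o1 \in F then 4 else 0) +
  ((if o2 \in F then 8 else 0) + ((if o3 \in F then 20 else 0) +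
   (if o4 \in F then 2 else 0)))).
Proof. by rewrite /ct big_mkcond big5. Qed.

Lemma cex_pz (F : {set 'I_5}) : pz cex F =
  (if o1 \in F then 8 else 0) + ((if (o2 \in F) || (o3 \in F) then 19 else 0) +
   (if o4 \in F then 1 else 0)).
Proof.
have [v1 v2 v3 v4] := cex_mem_vset F.
rewrite /pz big_mkcond big5 v1 v2 v3 v4 /= /cex_prize /=.
by rewrite !if_same !add0r.
Qed.

(** Only the access of [o1] and [o2] to the root is recorded; sets containing the cycle [o0], [o2],
    [o3] satisfy this too, but their density is far below 1. *)
Lemma cex_grown_inv (F : {set 'I_5}) : grown cex F ->
  (o1 \in F -> (o0 \in F) || (o2 \in F) && (o3 \in F)) /\
  (o2 \in F -> (o0 \in F) || (o3 \in F)).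
Proof.
elim=> [|{}F e x y gF [IH1 IH2] _ ends_e xF yF]; first by rewrite !inE.
have [v1 v2 v3 v4] := cex_mem_vset F.
have xe : x \in cex_ends e by rewrite [cex_ends e]ends_e set21.
have ye : y \in cex_ends e by rewrite [cex_ends e]ends_e set22.
have xy : x != y by apply: contraNneq yF => <-.
move: IH1 IH2 xF yF xe ye xy {ends_e}; rewrite !inE.
elim/ord5P: e => IH1 IH2 xF yF; rewrite /cex_ends /= !inE => /orP[]/eqP Ex /orP[]/eqP Ey;
  move: xF yF; rewrite Ex Ey ?eqxx //= ?rt_vset ?v1 ?v2 ?v3 ?v4; move: IH1 IH2;
  by do 4!case: (_ \in F).
Qed.

Lemma cex_endsE (e : 'I_5) : exists x y, cex_ends e = [set x; y] /\ x != y.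
Proof. by elim/ord5P: e; rewrite /cex_ends /=; do 2!eexists; split. Qed.

Lemma cex_admissible : admissible cex.
Proof.
split; first split.
- by rewrite inE.
- by move=> e _; apply: subsetT.
- by move=> e _; have [x [y [E _]]] := cex_endsE e; exists x, y.
- by move=> e _; elim/ord5P: e; rewrite /= /cex_cost /=; lra.
by move=> v _; elim/ord5P: v; rewrite /= /cex_prize /=; lra.
Qed.

Lemma cex_walk (v : 'I_5) : exists s,
  [/\ simple_path cex o0 s, walk_end o0 s = v & path_cost cex s = cex_dist v].
Proof.
elim/ord5P: v.
- by exists [::]; split=> //; rewrite /path_cost big_nil.
- exists [:: (o0, o1)]; rewrite /simple_path /path_cost /= !inE eqxx big_seq1.
  by split.
- exists [:: (o0, o1); (o1, o2)].
  rewrite /simple_path /path_cost /= !inE !eqxx big_cons big_seq1.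
  by split=> //; rewrite /= /cex_cost /cex_dist /=; lra.
- exists [:: (o3, o3)]; rewrite /simple_path /path_cost /= !inE eqxx big_seq1.
  by split.
exists [:: (o4, o4)]; rewrite /simple_path /path_cost /= !inE eqxx big_seq1.
by split.
Qed.

Lemma cex_instance : instance cex.
Proof.
have [[r0 sub _] cost0 prize0] := cex_admissible.
split=> //; first split=> //.
- by move=> e _; have [x [y [E xy]]] := cex_endsE e; rewrite /= E cards2 xy.
- move=> e f _ _ /= /setP ef; have := (ef o0, ef o1, ef o2, ef o3, ef o4).
  by elim/ord5P: e {ef}; elim/ord5P: f; rewrite /cex_ends /= !inE //= => -[[[[]]]].
move=> v _ _; have [s [/andP[ws _] es _]] := cex_walk v.
by exists s.
Qed.

(** [cex_dist] is a potential: along an edge it increases by at most the cost. This gives the lower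
    bound on all paths that [is_dist] demands. *)
Lemma cex_dist_walk (x : 'I_5) s :
  walk cex x s -> cex_dist (walk_end x s) <= cex_dist x + path_cost cex s.
Proof.
elim: s x => [|[e y] s IHs] x /=; first by rewrite /path_cost big_nil addr0.
move=> /and3P[_ /eqP ends_e /IHs le].
rewrite [path_cost _ _]big_cons addrA /=; apply: le_trans le _; rewrite lerD2r.
have xe : x \in cex_ends e by rewrite ends_e set21.
have ye : y \in cex_ends e by rewrite ends_e set22.
move: xe ye {ends_e}; elim/ord5P: e; rewrite /cex_ends /= !inE;
  by do 2!(case/orP => /eqP->); rewrite /cex_dist /cex_cost /=; lra.
Qed.

Lemma cex_eccentricity : is_eccentricity cex 20.
Proof.
have dist v : is_dist cex v (cex_dist v).
  split; first exact: cex_walk.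
  by move=> s /andP[ws _] <-; have := cex_dist_walk ws; rewrite add0r.
split; first by exists o3; rewrite ?inE //; apply: (dist o3).
move=> v _; exists (cex_dist v) => //.
by elim/ord5P: v; rewrite /cex_dist /=; lra.
Qed.

Let best : {set 'I_5} := [set o0; o1; o2].

Lemma cex_grown_leaf (F : {set 'I_5}) e : grown cex F ->
  (exists x y, [/\ cex_ends e = [set x; y], x \in vset cex F & y \notin vset cex F]) ->
  grown cex (e |: F).
Proof. by move=> gF [x [y [E xF yF]]]; apply: (grownU1 gF _ E xF yF); rewrite inE. Qed.

Lemma cex_grown0 : grown cex [set o0].
Proof.
rewrite -[[set o0]]setU0; apply: cex_grown_leaf; first exact: grown0.
by exists o0, o1; rewrite vset0 !inE.
Qed.

Lemma cex_grown02 : grown cex [set o0; o2].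
Proof.
rewrite setUC; apply: cex_grown_leaf; first exact: cex_grown0.
by exists o1, o3; have [-> _ -> _] := cex_mem_vset [set o0]; rewrite !inE.
Qed.

Lemma cex_grown_best : grown cex best.
Proof.
have -> : best = o1 |: [set o0; o2].
  by apply/setP => e; rewrite !inE; elim/ord5P: e.
apply: cex_grown_leaf; first exact: cex_grown02.
by exists o1, o2; have [-> -> _ _] := cex_mem_vset [set o0; o2]; rewrite !inE.
Qed.

Lemma cex_density (F : {set 'I_5}) : grown cex F ->
  pz cex F <= ct cex F /\ (pz cex F = ct cex F -> F != set0 -> F = best).
Proof.
move=> /cex_grown_inv; rewrite cex_pz cex_ct => inv.
(* Equality of sets is replaced by membership of the five edges, which leaves a check of 32 Boolean
   cases. *)
suff [le eq] : (pz cex F <= ct cex F) /\ (pz cex F = ct cex F ->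
   (forall e, (e \in F) = false) \/ forall e, (e \in F) = (e \in best)).
  split; first by rewrite -cex_pz -cex_ct.
  rewrite -cex_pz -cex_ct => /eq[F0|FE] Fne; last exact/setP.
  by case/set0Pn: Fne => e; rewrite F0.
rewrite cex_pz cex_ct; move: inv.
have E0 : (forall e, (e \in F) = false) <->
  [/\ (o0 \in F) = false, (o1 \in F) = false, (o2 \in F) = false,
      (o3 \in F) = false & (o4 \in F) = false].
  by split=> [h|[? ? ? ? ?] e]; [split|elim/ord5P: e].
have E1 : (forall e, (e \in F) = (e \in best)) <->
  [/\ (o0 \in F) = true, (o1 \in F) = true, (o2 \in F) = true,
      (o3 \in F) = false & (o4 \in F) = false].
  split=> [h|[? ? ? ? ?] e]; first by split; rewrite h !inE.
  by rewrite !inE; elim/ord5P: e.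
rewrite E0 E1.
case: (o0 \in F); case: (o1 \in F); case: (o2 \in F); case: (o3 \in F); case: (o4 \in F);
  move=> /= [i1 i2]; try (by have := i1 isT); try (by have := i2 isT);
  split; try lra; try (by move=> _; left); try (by move=> _; right);
  by move=> h; exfalso; lra.
Qed.

(** [best] forces the maximum density to be at least 1 and [cex_density] allows no more, so [M]
    attains equality there. *)
Lemma cex_first M d : tight cex set0 M d -> M = best.
Proof.
move=> tM; have gM := tight_grown tM; rewrite set0U in gM.
have [le eq] := cex_density gM; apply: eq (tight_neq0 tM); apply/eqP.
have pz0 : pz cex set0 = 0 by rewrite cex_pz !inE !addr0.
have ct0 : ct cex set0 = 0 by rewrite cex_ct !inE !addr0.
have dens := tight_density tM; rewrite set0U pz0 subr0 in dens.
have := tight_max tM cex_grown_best (sub0set _); rewrite pz0 ct0 !subr0.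
rewrite cex_pz cex_ct !inE /= => d1.
have c0 : 0 <= ct cex M by apply: ct_ge0; [exact: cex_admissible|exact: subsetT].
rewrite eq_le le dens -subr_ge0 -[X in _ - X]mul1r -mulrBl mulr_ge0 //; lra.
Qed.

Let H := as_graph (quot cex set0) (with_root (quot cex set0) best).

Lemma cex_tree_run d s : tight cex set0 best d -> tree_density_greedy H s ->
  exists s', s = [:: o0, o2 & s'].
Proof.
(* The sums have the shape that [cex_pz] and [cex_ct] produce. [n1] says that prize remains; [n2]
   and [n3] exclude a second min-max subtree made of [o1] and [o2] or of [o1] alone, since [o2]
   alone is denser. *)
have n1 : (0 + (0 + 0) : R) <> 8 + (19 + 0) by lra.
have n2 (x : R) : 0 + (19 + 0) - (0 + (0 + 0)) <=
  x * (15 + (0 + (8 + (0 + 0))) - (15 + (0 + (0 + (0 + 0))))) ->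
  8 + (19 + 0) - (0 + (0 + 0)) = x * (0 + (4 + (8 + (0 + 0)))) -> False by lra.
have n3 (x : R) : 0 + (19 + 0) - (0 + (0 + 0)) <=
  x * (15 + (0 + (8 + (0 + 0))) - (15 + (0 + (0 + (0 + 0))))) ->
  8 + (0 + 0) - (0 + (0 + 0)) = x * (0 + (4 + (0 + (0 + 0)))) -> False by lra.
move=> tB run; have g0 := grown0 cex.
have admH := admissible_min_max cex_admissible g0 tB.
have gH := grown_min_max cex_admissible g0 tB.
have vH := @verts_min_max R _ _ cex set0 best.
have eH : edges H = best := @edges_min_max R _ _ cex set0 best.
have [pa [ch [rp tO]]] := tree_orderE gH.
have wfG : wf_mgraph cex by have [] := cex_admissible.
have growP X : grown H X <-> X \subset best /\ grown cex X.
  rewrite (grown_min_maxP cex_admissible g0 tB).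
  split=> -[sX gX]; split=> //.
    by have [] := grown_quot_sub wfG g0 gX; rewrite set0U.
  by apply: grown_quot; rewrite ?set0U ?disjoints_subset ?sub0set.
have pzH X : pz H X = pz cex X.
  by rewrite pz_min_max set0U [pz cex set0]cex_pz !inE !addr0 subr0.
have ctH X : ct H X = ct cex X by [].
move: run; rewrite /tree_density_greedy root_onlyE => run.
have [[_]|[e [s1 [M1 [d1 [-> tM1 [eM1 ge _] run1]]]]]] :=
  tree_run_inv admH gH vH tO (grown0 H) erefl run.
  by rewrite !pzH eH !cex_pz !inE /= => /n1.
have {ge tM1 eM1} e0 : e = o0.
  move/growP: ge; rewrite setU0 => -[]; rewrite sub1set => eB /cex_grown_inv.
  by move: eB; rewrite !inE => /orP[/orP[]|]/eqP-> //= [] // i1 i2;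
    [have := i1 isT|have := i2 isT].
rewrite e0 setU0 in run1 *.
have gH0 : grown H [set o0].
  by apply/growP; split; [rewrite sub1set !inE|exact: cex_grown0].
have [[_]|[f [s2 [M2 [d2 [-> tM2 [fM2 gf _] _]]]]]] :=
  tree_run_inv admH gH vH tO gH0 erefl run1.
  by rewrite !pzH eH !cex_pz !inE /= => /n1.
exists s2; congr [:: _, _ & _].
have d0 := tight_disjoint tM2; rewrite disjoints_subset sub1set inE in d0.
have gM2 := tight_grown tM2; have /growP[sM2 _] := gM2.
have notM e' : e' \notin best -> (e' \in M2) = false.
  move=> e'B; apply: contraNF e'B => e'M; apply: (subsetP sM2).
  by rewrite inE e'M orbT.
have fB : f \in best by apply: (subsetP sM2); rewrite inE fM2 orbT.
move: fB fM2; rewrite !inE => /orP[/orP[]|]/eqP-> //.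
  by rewrite (negPf d0).
move=> sM; exfalso; have := tight_density tM2.
have gH02 : grown H [set o0; o2].
  apply/growP; split; last exact: cex_grown02.
  by apply/subsetP => e'; rewrite !inE => /orP[]/eqP->.
have := tight_max tM2 gH02 (subsetUl _ _).
rewrite !pzH !ctH !cex_pz !cex_ct !inE /= sM (negPf d0) (notM o3) ?(notM o4) ?inE //=.
case: (o2 \in M2) => /=; [exact: n2|exact: n3].
Qed.

Lemma cex_alg pi mu : density_greedy cex pi ->
  mu * sprize cex (alg cex pi (2 + 20)) < sprize cex (with_root cex [set o4]).
Proof.
have admG := cex_admissible; have g0 := grown0 cex.
have reachG v : v \in verts cex -> 0 < prize cex v -> reachable cex (rt cex) v.
  by have [_ _ _] := cex_instance; apply.
rewrite /density_greedy root_onlyE => run.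
have [[_]|[M [d [sigma [pi' [-> tM tree_run _]]]]]] := graph_run_inv admG reachG g0 erefl run.
  rewrite /total_prize cex_pz (eq_bigl predT); last by move=> v; rewrite inE.
  rewrite big5 /= /cex_prize !inE /=; lra.
have MB := cex_first tM; rewrite MB in tM tree_run.
have [s' ->] := cex_tree_run tM tree_run.
rewrite /alg; set F := [set tnth _ _ | _ in _].
(* Any index after the first needs at least 15 + 8 = 23, more than the budget 22. Vertex 1 bears no
   prize, so the value is 0 and no factor [mu] can help. *)
have sF : F \subset [set o0].
  apply/subsetP => x /imsetP[[[|i] lti] le ->] {x}; first by rewrite (tnth_nth o0) !inE.
  move: le.
  rewrite inE /= !big_cons /= /cex_cost /= => le; exfalso.
  have : 0 <= \sum_(j <- take i (s' ++ pi')) cex_cost j.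
    by apply: sumr_ge0 => j _; apply/ltW; have [_ cG _] := admG; apply: cG; rewrite inE.
  by move: le; rewrite /cex_cost; lra.
have -> : sprize cex (with_root cex F) = 0.
  rewrite sprizeE cex_pz.
  have F0 e : e != o0 -> (e \in F) = false.
    by move=> e0; apply: contraNF e0 => /(subsetP sF); rewrite inE.
  by rewrite !F0 // !addr0.
by rewrite mulr0 sprizeE cex_pz !inE /=; lra.
Qed.

Lemma cex_optimal : optimal cex 2 (with_root cex [set o4]).
Proof.
have wfG : wf_mgraph cex by have [] := cex_admissible.
have g4 : grown cex [set o4].
  rewrite -[[set o4]]setU0; apply: cex_grown_leaf; first exact: grown0.
  by exists o0, o4; rewrite vset0 !inE.
split; first exact: grown_rooted_subtree.
  by rewrite scostE cex_ct !inE /=; lra.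
move=> T' /(rooted_subtree_grown wfG)[-> _]; rewrite scostE !sprizeE.
move: T'.2 => F; rewrite cex_ct !cex_pz !inE /=.
case: (o0 \in F); case: (o1 \in F); case: (o2 \in F); case: (o3 \in F); case: (o4 \in F);
  move=> /= le; lra.
Qed.

End Counterexample.

Theorem theorem3 (R : realType) :
  competitive (@density_greedy R) (@is_max_path_cost R) 2 /\
  (forall mu : R, 1 <= mu ->
     ~ competitive (@density_greedy R) (@is_eccentricity R) mu) /\
  (exists (V E : finType) (G : rooted_mgraph R V E) (chi : R),
     [/\ instance G, is_eccentricity G chi,
         exists pi : seq E, density_greedy G pi
       & forall pi : seq E, density_greedy G pi ->
         forall mu : R, 1 <= mu ->
         exists2 B : R, 0 <= B &
         exists2 T : sgraph V E, optimal G B T &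
           mu * sprize G (alg G pi (B + chi)) < sprize G T]).
Proof.
have admissible_instance V E (G : rooted_mgraph R V E) : instance G -> admissible G.
  move=> [[rG sub card2 _] cG pG _]; split=> //; split=> // e /card2/eqP/cards2P[x [y [_ ->]]].
  by exists x, y.
have reach_instance V E (G : rooted_mgraph R V E) : instance G ->
    forall v, v \in verts G -> 0 < prize G v -> reachable G (rt G) v by case.
have exists_run V E (G : rooted_mgraph R V E) : instance G ->
    exists pi, density_greedy G pi.
  by move=> iG; apply: density_greedy_exists (admissible_instance _ _ _ iG) (reach_instance _ _ _ iG).
split; [|split].
- move=> V E G iG gamma [_ maxg]; split; first exact: exists_run.
  move=> pi; apply: density_greedy_competitive => //.
    exact: admissible_instance.
  exact: reach_instance.
- move=> mu _ comp; have [[pi run] comp_pi] := comp _ _ _ (cex_instance R) _ (cex_eccentricity R).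
  have [_ /(_ 2 (ler0n _ _) _ (cex_optimal R))] := comp_pi pi run.
  by rewrite leNgt cex_alg.
exists 'I_5, 'I_5, (cex R), 20; split.
- exact: cex_instance.
- exact: cex_eccentricity.
- exact/exists_run/cex_instance.
move=> pi run mu _; exists 2; first exact: ler0n.
by exists (with_root (cex R) [set @Ordinal 5 4 isT]); [exact: cex_optimal|exact: cex_alg].
Qed.
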